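(* For every $\alpha\in[0,1)$ there is a constant $c_\alpha$, depending only on $\alpha$, such that the following holds for every positive integer $N$, for $G$ either the cyclic group $\mathbb{Z}_N$ generated by $y$ with $y^N=1$, or the dihedral group $D_{2N}$ of order $2N$ generated by $\sigma$ and $\tau$ with $\sigma^N=\tau^2=(\sigma\tau)^2=1_G$, for every $f\in\mathbb{C}[G]$ with $1_G\succeq f\succeq\alpha1_G$, and for every positive integer $d$: $$\delta_d\le\begin{cases}\dfrac{c_\alpha}{\sqrt{2d-1}}\left(\dfrac{1-\alpha^2}{1+\alpha^2}\right)^{d}\omega_{d,f} & \text{if }0<\alpha<1,\\[2mm]\dfrac{c_0}{d}\,\omega_{d,f} & \text{if }\alpha=0.\end{cases}$$ Here $\delta_d:=\min\{\lambda\ge0: f+\lambda1_G=f_Q\text{ for some }Q\in\mathbb{C}^{S_d\times S_d},\ Q=Q^{\mathsf H},\ Q\succeq0\}$, and $\omega_{d,f}$ is defined as follows. For $G=\mathbb{Z}_N$, $\omega_{d,f}:=3\sqrt{4dk+1}$, where $k$ is the smallest positive integer such that $$\operatorname{supp}(f)\subseteq\{y^r:0\le r\le k\}\cup\{y^{N-r}:0\le r\le k\}.$$ For $G=D_{2N}$, $\omega_{d,f}:=3\sqrt{8dk+1}$, where $k$ is the smallest positive integer such that $$\operatorname{supp}(f)\subseteq\{\sigma^r:0\le r\le k\}\cup\{\sigma^{N-r}:0\le r\le k\}\cup\{\sigma^r\tau:0\le r\le k\}\cup\{\sigma^{N-r}\tau:0\le r\le k\}.$$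
   Context: For a finite group $G$ with identity $1_G$, every $f\in\mathbb{C}[G]$ is written $f=\sum_{x\in G}C_f(x)x$ with $C_f:G\to\mathbb{C}$; $f^*=\sum_{x}\overline{C_f(x)}x^{-1}$; $\operatorname{supp}(f)=\{x\in G:C_f(x)\ne0\}$. A $*$-representation of $\mathbb{C}[G]$ is an algebra homomorphism $\pi:\mathbb{C}[G]\to\mathbb{C}^{n\times n}$ with $\pi(x)$ unitary for $x\in G$ and $\pi(f^* )=\pi(f)^{\mathsf H}$ (conjugate transpose). The notation $1_G\succeq f\succeq\alpha1_G$ means that $f=f^*$ and, for every $*$-representation $\pi$, all eigenvalues of the Hermitian matrix $\pi(f)$ lie in $[\alpha,1]$. For $k\ge 0$ let $p_{\alpha,k}$ be the real univariate polynomial of degree at most $k$ that is the best uniform approximation of $\sqrt t$ on $[\alpha,1]$, i.e. the minimizer of $\max_{t\in[\alpha,1]}|p(t)-\sqrt t|$ over real polynomials $p$ of degree at most $k$. For $f\in\mathbb{C}[G]$ with $1_G\succeq f\succeq\alpha1_G$, $p_{\alpha,k}(f)\in\mathbb{C}[G]$ is obtained by evaluating the polynomial at $f$ (the constant term being multiplied by $1_G$), and $S_d:=\bigcup_{0\le k\le d}\operatorname{supp}(p_{\alpha,k}(f))\subseteq G$. For $Q\in\mathbb{C}^{S_d\times S_d}$ (a matrix with rows and columns indexed by $S_d$), $f_Q:=\sum_{x,y\in S_d}Q(x,y)\,x^{-1}y\in\mathbb{C}[G]$. *)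

(* Defs.v *)
From HB Require Import structures.
From mathcomp Require Import all_boot all_order all_algebra all_fingroup.
From mathcomp Require Import complex.
From mathcomp Require Import boolp classical_sets reals.

Set Implicit Arguments.
Unset Strict Implicit.
Unset Printing Implicit Defensive.

Import Order.TTheory GRing.Theory Num.Theory.

Local Open Scope ring_scope.

(* An alias of [{ffun gT -> K}], whose canonical ring product is pointwise:
   here the product is the convolution. *)
Definition group_algebra (K : comNzRingType) (gT : finGroupType) : Type :=
  {ffun gT -> K}.

Section GroupAlgebra.
Variables (K : comNzRingType) (gT : finGroupType).
Local Notation A := (group_algebra K gT).

HB.instance Definition _ := GRing.Lmodule.copy A {ffun gT -> K^o}.

Definition gcoef (f : A) (x : gT) : K := (f : {ffun gT -> K}) x.

Definition gelt (x : gT) : A := [ffun z => (z == x)%:R].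

Definition gmul (f g : A) : A :=
  [ffun z => \sum_(x : gT) gcoef f x * gcoef g (x^-1 * z)%g].

Lemma galgP (f g : A) : gcoef f =1 gcoef g -> f = g.
Proof. by move=> fg; apply/ffunP. Qed.

Lemma gcoefD (f g : A) x : gcoef (f + g) x = gcoef f x + gcoef g x.
Proof. by rewrite /gcoef ffunE. Qed.

Lemma gcoefZ a (f : A) x : gcoef (a *: f) x = a * gcoef f x.
Proof. by rewrite /gcoef ffunE. Qed.

Lemma gcoef_elt x z : gcoef (gelt x) z = (z == x)%:R.
Proof. by rewrite /gcoef ffunE. Qed.

Lemma gcoefM (f g : A) z :
  gcoef (gmul f g) z = \sum_(x : gT) gcoef f x * gcoef g (x^-1 * z)%g.
Proof. by rewrite {1}/gcoef ffunE. Qed.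

Fact gmulA : associative gmul.
Proof.
move=> f g h; apply: galgP => z; rewrite !gcoefM.
under eq_bigr => x _ do rewrite gcoefM mulr_sumr.
under [RHS]eq_bigr => x _ do rewrite gcoefM mulr_suml.
rewrite [RHS]exchange_big /=; apply: eq_bigr => x _.
rewrite (reindex_inj (mulgI x^-1)%g) /=; apply: eq_bigr => y _.
by rewrite mulrA invMg invgK -!mulgA mulKVg.
Qed.

Fact gmul1f : left_id (gelt 1%g) gmul.
Proof.
move=> f; apply: galgP => z; rewrite gcoefM (bigD1 1%g) //= big1.
  by rewrite gcoef_elt eqxx mul1r invg1 mul1g addr0.
by move=> x /negbTE xN1; rewrite gcoef_elt xN1 mul0r.
Qed.

Fact gmulf1 : right_id (gelt 1%g) gmul.
Proof.
move=> f; apply: galgP => z; rewrite gcoefM (bigD1 z) //= big1.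
  by rewrite gcoef_elt mulVg eqxx mulr1 addr0.
move=> x xNz; rewrite gcoef_elt -eq_mulVg1 (negbTE xNz).
by rewrite mulr0.
Qed.

Fact gmulDl : left_distributive gmul +%R.
Proof.
move=> f g h; apply: galgP => z; rewrite gcoefD !gcoefM -big_split /=.
by apply: eq_bigr => x _; rewrite gcoefD mulrDl.
Qed.

Fact gmulDr : right_distributive gmul +%R.
Proof.
move=> f g h; apply: galgP => z; rewrite gcoefD !gcoefM -big_split /=.
by apply: eq_bigr => x _; rewrite gcoefD mulrDr.
Qed.

Fact gelt1_neq0 : gelt 1%g != 0.
Proof.
apply/eqP => /ffunP/(_ 1%g); rewrite !ffunE eqxx => /eqP.
by rewrite oner_eq0.
Qed.

HB.instance Definition _ := GRing.Zmodule_isNzRing.Build A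
  gmulA gmul1f gmulf1 gmulDl gmulDr gelt1_neq0.

Lemma galg_oneE : 1 = gelt 1%g :> A. Proof. by []. Qed.

Lemma galg_mulE (f g : A) : f * g = gmul f g. Proof. by []. Qed.

Fact gscaleAl (a : K) (f g : A) : a *: (f * g) = (a *: f) * g.
Proof.
apply: galgP => z; rewrite gcoefZ !gcoefM mulr_sumr.
by apply: eq_bigr => x _; rewrite gcoefZ mulrA.
Qed.

HB.instance Definition _ := GRing.Lmodule_isLalgebra.Build K A gscaleAl.

Fact gscaleAr (a : K) (f g : A) : a *: (f * g) = f * (a *: g).
Proof.
apply: galgP => z; rewrite gcoefZ !gcoefM mulr_sumr.
by apply: eq_bigr => x _; rewrite gcoefZ mulrCA.
Qed.

HB.instance Definition _ := GRing.Lalgebra_isAlgebra.Build K A gscaleAr.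

Definition gsupp (f : A) : {set gT} := [set x | gcoef f x != 0].

End GroupAlgebra.

Arguments gelt {K gT} x.

Section StarAlgebra.
Variables (C : numClosedFieldType) (gT : finGroupType).
Local Notation A := (group_algebra C gT).
Local Open Scope sesquilinear_scope.

Definition gstar (f : A) : A := [ffun x => Num.conj (gcoef f x^-1%g)].

(* The size is [n.+1] because a representation on the zero space has no
   eigenvalue. *)
Definition star_representation (n : nat)
    (rho : {lrmorphism A -> 'M[C]_n.+1}) : Prop :=
  (forall x : gT, rho (gelt x) \is unitarymx) /\
  (forall f : A, rho (gstar f) = (rho f)^t*).

(* b 1_G >= f >= a 1_G *)
Definition gbetween (a b : C) (f : A) : Prop :=
  f = gstar f /\
  forall (n : nat) (rho : {lrmorphism A -> 'M[C]_n.+1}),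
    star_representation rho ->
    forall l : C, eigenvalue (rho f) l -> a <= l <= b.

Definition psdmx (m : nat) (Q : 'M[C]_m) : Prop :=
  Q \is hermsymmx /\ forall v : 'cV[C]_m, 0 <= (v^t* *m Q *m v) 0 0.

Definition gram_elt (S : {set gT}) (Q : 'M[C]_#|S|) : A :=
  \sum_(i < #|S|) \sum_(j < #|S|)
    Q i j *: gelt ((enum_val i)^-1 * enum_val j)%g.

End StarAlgebra.

Section SquareRoot.
Variable R : realType.
Local Open Scope classical_set_scope.
Local Open Scope complex_scope.

Definition is_min (E : set R) (m : R) : Prop := E m /\ lbound E m.

Definition sqrt_error (alpha : R) (p : {poly R}) : R :=
  sup [set `|p.[t] - Num.sqrt t| | t in [set t : R | alpha <= t <= 1]].

Definition is_best_sqrt_approx (alpha : R) (k : nat) (p : {poly R}) : Prop :=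
  (size p <= k.+1)%N /\
  forall q : {poly R}, (size q <= k.+1)%N ->
    sqrt_error alpha p <= sqrt_error alpha q.

Definition best_sqrt_approx (alpha : R) (k : nat) : {poly R} :=
  xget 0 [set p | is_best_sqrt_approx alpha k p].

Variable gT : finGroupType.
Local Notation A := (group_algebra R[i] gT).

Definition geval (p : {poly R}) (f : A) : A :=
  horner_alg f (map_poly (real_complex R) p).

Definition sqrt_supp (alpha : R) (f : A) (d : nat) : {set gT} :=
  (\bigcup_(k < d.+1) gsupp (geval (best_sqrt_approx alpha k) f))%SET.

Definition gram_shifts (alpha : R) (f : A) (d : nat) : set R :=
  [set l : R | 0 <= l /\
    exists Q : 'M[R[i]]_#|sqrt_supp alpha f d|,
      psdmx Q /\ f + l%:C *: 1 = gram_elt Q].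

End SquareRoot.

Section Bandwidth.
Variable gT : finGroupType.

Definition cyclic_band (N : nat) (y : gT) (k : nat) : {set gT} :=
  ([set y ^+ r | r : 'I_k.+1] :|: [set y ^+ (N - r) | r : 'I_k.+1])%g.

Definition dihedral_band (N : nat) (s t : gT) (k : nat) : {set gT} :=
  (cyclic_band N s k :|: [set x * t | x in cyclic_band N s k])%g.

(* In the bands above [N - r] is truncated, but this is harmless: [k = N] is
   always wide enough, so the smallest [k] is at most [N]. *)
Definition is_bandwidth (B : nat -> {set gT}) (S : {set gT}) (k : nat) : Prop :=
  [/\ (0 < k)%N, S \subset B k &
      forall j, (0 < j)%N -> S \subset B j -> (k <= j)%N].

End Bandwidth.

Definition delta_bound (R : realType) (alpha c : R) (d : nat) (omega : R) : R :=
  if 0 < alpha then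
    c / Num.sqrt (2 * d%:R - 1)
      * ((1 - alpha ^+ 2) / (1 + alpha ^+ 2)) ^+ d * omega
  else c / d%:R * omega.

(* Main.v *)
Require Import Defs.
From HB Require Import structures.
From mathcomp Require Import all_boot all_order all_algebra all_fingroup.
From mathcomp Require Import complex.
From mathcomp Require Import boolp classical_sets reals.
From mathcomp Require Import functions topology normedtype derive.
From mathcomp Require Import ring lra zify.

Set Implicit Arguments.
Unset Strict Implicit.
Unset Printing Implicit Defensive.

Import Order.TTheory GRing.Theory Num.Theory.
Import numFieldNormedType.Exports.

Local Open Scope ring_scope.

(** Let [p] be the best approximation of the square root of degree at most [d],
with uniform error [e <= 1] on [[alpha, 1]], and let [g = f - p(f)^2]. Since
[|t - p(t)^2| <= e (2 + e) <= 3 e] on the spectrum of [f], the operator norm of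
[g] in the regular representation is at most [3 e], and so is the l^2-norm of
its coefficients ([sum_sqr_horner_le]). By Cauchy-Schwarz their l^1-norm [l] is
at most [3 e] times the square root of the size of the support of [g]. As
[p(f)] is self-adjoint, [f + l = p(f)^* p(f) + (g + l)], where [g + l] is a sum
of squares of binomials [x + u y] because every term [c z] of [g] is absorbed by
[|c|] ([has_psd_gram_l1]). All these squares live on [S_d]: the polynomial of
degree 0 puts the identity into [S_d], and the one of degree 1, which has a
nonzero slope, puts the support of [f] there. This is [gram_certificate].

The support of [g], a polynomial of degree [2 d] in [f], lies in the band of
width [2 d k], which has at most [4 d k + 1] elements in the cyclic case and
[8 d k + 2] in the dihedral case; a factor 2 in the constant pays for the
difference with [8 d k + 1].

It remains to bound [e]. For [alpha > 0] the Taylor polynomials at the midpoint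
of [[alpha, 1]] converge at the rate [(1 - alpha) / (1 + alpha)], which is
strictly better than [(1 - alpha^2) / (1 + alpha^2)] and so leaves room for the
factor [sqrt (2 d - 1)] ([sqrt_approx_geometric]). For [alpha = 0] an explicit
Jackson type construction gives an error [12 / d] ([sqrt_approx_linear]): with
[x = sqrt t], integrate over [[0, x]] the square of the polynomial
[sin ((2 n + 1) th) / sin th] in [s = sin th], normalise to get an approximation
of the sign of [x], and multiply by [x].

Both minima in the statement, the best approximation and the smallest shift,
are optima of linear programs with infinitely many constraints over a space of
finite dimension, and are reached by compactness ([linear_program_attained]). *)

(** * Approximation of the square root at a geometric rate *)

Section GeometricRate.
Variable R : realType.
Implicit Types (p q g : {poly R}) (a t u : R).
Local Notation nneg_coef := (@Num.Def.nneg_num_pred R).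

Lemma norm_horner_le_nneg p u : p \is a polyOver nneg_coef -> `|u| <= 1 ->
  `|p.[u]| <= p.[1].
Proof.
move=> /polyOverP p0 u1; rewrite !horner_coef.
apply: le_trans (ler_norm_sum _ _ _) _; apply: ler_sum => i _.
rewrite expr1n mulr1 normrM normrX ger0_norm; last by have := p0 i; rewrite nnegrE.
by rewrite ler_piMr ?exprn_ile1 //; have := p0 i; rewrite nnegrE.
Qed.

Lemma horner1_nneg p : p \is a polyOver nneg_coef -> 0 <= p.[1].
Proof.
by move=> /norm_horner_le_nneg p1; apply: le_trans (p1 1 _); rewrite ?normr1.
Qed.

(** The truncations [1 - X g] of the binomial series of [sqrt (1 - X)]: each
step cancels the lowest coefficient [2 h] of the defect by subtracting
[h X^(n+1)], and the defect keeps nonnegative coefficients. *)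
Lemma sqrt_series n : exists g q, [/\ g \is a polyOver nneg_coef /\
    q \is a polyOver nneg_coef, (size g <= n)%N,
    (1 - 'X * g) ^+ 2 = 1 - 'X + 'X^(n.+1) * q & g.[1] <= 1].
Proof.
elim: n => [|n [g [q [[g0 q0] szg gq g1]]]].
  exists 0, 1; split; rewrite ?size_poly0 ?horner0 ?ler01 //.
    by split; [exact: rpred0 | exact: rpred1].
  by rewrite mulr0 subr0 expr1n mulr1 subrK.
pose h := q`_0 / 2; pose q1 := drop_poly 1 q.
have qE : q = q1 * 'X + (2 * h)%:P.
  rewrite -[LHS](poly_take_drop 1) expr1 addrC; congr (_ + _).
  apply/polyP => i; rewrite coef_take_poly coefC /h mulrCA divff ?mulr1 ?pnatr_eq0 //.
  by case: i.
have h0 : 0 <= h.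
  by rewrite /h divr_ge0 ?ler0n //; have /polyOverP/(_ 0%N) := q0; rewrite nnegrE.
have hN : h%:P \is a polyOver nneg_coef by rewrite polyOverC nnegrE.
have q1N : q1 \is a polyOver nneg_coef.
  by apply/polyOverP => i; rewrite coef_drop_poly; apply: (polyOverP q0).
have XN : 'X \is a polyOver nneg_coef by rewrite polyOverX.
exists (g + h%:P * 'X^n), (q1 + (h%:P *+ 2 * g + h%:P ^+ 2 * 'X^n)); split.
- by split; rewrite !(rpredD, rpredM, rpredMn, rpredX).
- rewrite (leq_trans (size_polyD _ _)) // geq_max (leqW szg) mul_polyC.
  by rewrite (leq_trans (size_scale_leq _ _)) // size_polyXn.
- have -> : (1 - 'X * (g + h%:P * 'X^n)) ^+ 2 =
    (1 - 'X * g) ^+ 2 - (1 - 'X * g) * (h%:P * 'X^(n.+1)) *+ 2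
      + h%:P ^+ 2 * 'X^n * 'X^(n.+2) by rewrite !exprS; ring.
  by rewrite gq {1}qE polyCM !exprS; ring.
have q1_ge : 2 * h <= q.[1].
  by rewrite qE !hornerE lerDr horner1_nneg.
have g1_0 := horner1_nneg g0.
have : (1 - g.[1]) ^+ 2 = q.[1].
  have := congr1 (fun p => p.[1]) gq; rewrite !hornerE expr1n.
  by rewrite mul1r => ->; ring.
rewrite !hornerE expr1n mulr1; nra.
Qed.

(** The error is controlled by the defect of the square, through
[|p - s| s <= |p - s| (p + s) = |p^2 - s^2|] with [s = sqrt (1 - u)]; the defect
[u^(n+1) q(u)] is at most [|u|^(n+1)] because [q(1) = (1 - g(1))^2 <= 1]. *)
Lemma sqrt_taylor n : exists2 p : {poly R}, (size p <= n.+1)%N &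
  forall u, `|u| < 1 ->
    `|p.[u] - Num.sqrt (1 - u)| * Num.sqrt (1 - u) <= `|u| ^+ n.+1.
Proof.
have [g [q [[g0 q0] szg gq g1]]] := sqrt_series n; exists (1 - 'X * g).
  rewrite (leq_trans (size_polyD _ _)) // geq_max size_poly1 size_polyN /=.
  have [->|gn0] := eqVneq g 0; first by rewrite mulr0 size_poly0.
  by rewrite mulrC size_mulX.
move=> u u1; set p := 1 - _; set s := Num.sqrt _.
have s0 : 0 <= s := sqrtr_ge0 _.
have u1' : u <= 1 by rewrite (le_trans (ler_norm _)) // ltW.
have s2 : s ^+ 2 = 1 - u by rewrite sqr_sqrtr // subr_ge0.
have gu := norm_horner_le_nneg g0 (ltW u1).
have qu := norm_horner_le_nneg q0 (ltW u1).
have q1 : q.[1] <= 1.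
  have g1_0 := horner1_nneg g0.
  have := congr1 (fun p => p.[1]) gq; rewrite !hornerE expr1n mul1r; nra.
have p0 : 0 <= p.[u].
  rewrite !hornerE subr_ge0 (le_trans (ler_norm _)) // normrM.
  by rewrite mulr_ile1 // ?(ltW u1) // (le_trans gu).
have pE : p.[u] ^+ 2 = 1 - u + u ^+ n.+1 * q.[u].
  by have := congr1 (fun p => p.[u]) gq; rewrite !hornerE.
apply: (@le_trans _ _ (`|p.[u] - s| * (p.[u] + s))).
  by rewrite ler_wpM2l // lerDr.
rewrite -[X in _ * X]ger0_norm ?addr_ge0 // -normrM -subr_sqr s2 pE addrC addKr.
by rewrite normrM normrX ler_piMr ?exprn_ge0 // (le_trans qu).
Qed.

(** The series is centred at the midpoint [m] of [[a, 1]]: for [t = m (1 - u)],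
the interval becomes the disk [|u| <= (1 - a) / (1 + a)]. *)
Lemma sqrt_approx_disk a n : 0 < a -> a <= 1 ->
  exists2 p : {poly R}, (size p <= n.+1)%N & forall t, a <= t <= 1 ->
    `|p.[t] - Num.sqrt t| <= ((1 - a) / (1 + a)) ^+ n.+1 / Num.sqrt a.
Proof.
move=> a0 a1; have [p szp pE] := sqrt_taylor n.
pose m := (1 + a) / 2; have m0 : 0 < m by rewrite /m; lra.
have m1 : m <= 1 by rewrite /m; lra.
exists (Num.sqrt m *: (p \Po (1 - m^-1 *: 'X))).
  rewrite (leq_trans (size_scale_leq _ _)) //.
  rewrite (leq_trans (size_comp_poly_leq _ _)) // ltnS.
  rewrite -[leqRHS]muln1 leq_mul //; first by case: (size p) szp.
  suff : (size (1 - m^-1 *: 'X : {poly R})%R <= 2)%N by case: (size _).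
  rewrite (leq_trans (size_polyD _ _)) // geq_max size_poly1 size_polyN /=.
  by rewrite (leq_trans (size_scale_leq _ _)) // size_polyX.
move=> t /andP[at1 t1]; have t0 : 0 < t := lt_le_trans a0 at1.
rewrite !hornerE horner_comp !hornerE; set u := 1 - _.
have tE : t = m * (1 - u) by rewrite /u; field; rewrite gt_eqF.
have u1 : `|u| <= (1 - a) / (1 + a).
  have -> : u = (1 + a - 2 * t) / (1 + a).
    by rewrite /u /m; field; rewrite gt_eqF //; lra.
  rewrite normrM [`|_^-1|]ger0_norm ?invr_ge0; last lra.
  by rewrite ler_wpM2r ?invr_ge0 ?ler_norml; [|lra|lra].
have r1 : (1 - a) / (1 + a) < 1 by rewrite ltr_pdivrMr; lra.
have := pE u (le_lt_trans u1 r1).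
set s := Num.sqrt (1 - u) => err.
have sE : Num.sqrt t = Num.sqrt m * s by rewrite tE sqrtrM // ltW.
have s0 : 0 < s.
  by rewrite sqrtr_gt0 -(pmulr_rgt0 _ m0) -tE.
have mE : Num.sqrt m ^+ 2 = m by rewrite sqr_sqrtr // ltW.
rewrite ler_pdivlMr ?sqrtr_gt0 //.
apply: (@le_trans _ _ (`|Num.sqrt m * p.[u] - Num.sqrt t| * Num.sqrt t)).
  by rewrite ler_wpM2l // ler_wsqrtr.
rewrite sE -mulrBr normrM ger0_norm ?sqrtr_ge0 //.
have -> : Num.sqrt m * `|p.[u] - s| * (Num.sqrt m * s) = m * (`|p.[u] - s| * s).
  by rewrite -[in RHS]mE; ring.
apply: le_trans (_ : `|u| ^+ n.+1 <= _); last first.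
  by rewrite lerXn2r ?nnegrE // (le_trans _ u1).
by apply: le_trans err; rewrite ler_piMl // mulr_ge0 // ltW.
Qed.

(** The rate of the Taylor series leaves room: [(1 - a) / (1 + a)] is strictly
smaller than [(1 - a^2) / (1 + a^2)], and the ratio beats [sqrt (2 d - 1)]. *)
Lemma sqrt_approx_geometric a : 0 < a -> a < 1 -> exists c, 0 <= c /\
  forall d, (0 < d)%N -> exists2 p : {poly R}, (size p <= d.+1)%N &
    forall t, a <= t <= 1 -> `|p.[t] - Num.sqrt t| <=
      c / Num.sqrt (2 * d%:R - 1) * ((1 - a ^+ 2) / (1 + a ^+ 2)) ^+ d.
Proof.
move=> a0 a1; set r := (1 - a) / (1 + a); set q := (1 - _) / _.
have r0 : 0 < r by rewrite divr_gt0; lra.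
have a20 : 0 < 1 + a ^+ 2 by rewrite ltr_wpDr // exprn_ge0 // ltW.
have a10 : 0 < 1 + a by rewrite ltr_wpDr // ltW.
have rq : r < q.
  rewrite -subr_gt0.
  have -> : q - r = (1 - a) * (2 * a) / ((1 + a) * (1 + a ^+ 2)).
    by rewrite /q /r; field; rewrite !gt_eqF.
  by rewrite divr_gt0 ?mulr_gt0 // subr_gt0.
pose D := q / r - 1; have D0 : 0 < D by rewrite subr_gt0 ltr_pdivlMr // mul1r.
have sa : 0 < Num.sqrt a by rewrite sqrtr_gt0.
exists (2 / (D * Num.sqrt a)); split; first by rewrite divr_ge0 // mulr_ge0 // ltW.
move=> d d0; have [p szp pE] := sqrt_approx_disk d a0 (ltW a1).
exists p => // t /pE /le_trans; apply.
have dR : 1 <= d%:R :> R by rewrite ler1n.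
set w := Num.sqrt (2 * d%:R - 1).
have w0 : 0 < w by rewrite sqrtr_gt0; lra.
have w2 : w <= 2 * d%:R.
  rewrite -[leRHS](@ger0_norm _ (2 * d%:R)) ?mulr_ge0 // -sqrtr_sqr ler_wsqrtr //; nra.
(* Bernoulli's inequality makes the geometric gap beat the linear factor *)
have bern : d%:R * D <= (q / r) ^+ d.
  have : forall k : nat, 1 + k%:R * D <= (1 + D) ^+ k.
    elim=> [|k IH]; first by rewrite mul0r addr0 expr0.
    rewrite exprS -natr1; have kR : 0 <= k%:R :> R by []; nra.
  move=> /(_ d); have -> : 1 + D = q / r by rewrite /D; ring.
  by apply: le_trans; rewrite lerDr.
have rd0 : 0 < r ^+ d by rewrite exprn_gt0.
have qd : d%:R * D * r ^+ d <= q ^+ d.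
  by move: bern; rewrite expr_div_n ler_pdivlMr.
have r1 : r <= 1 by rewrite ler_pdivrMr; lra.
rewrite ler_pdivrMr //.
have -> : 2 / (D * Num.sqrt a) / w * q ^+ d * Num.sqrt a = 2 / (D * w) * q ^+ d.
  by field; rewrite !gt_eqF.
rewrite mulrAC ler_pdivlMr ?mulr_gt0 //.
apply: le_trans (_ : r ^+ d * (D * w) <= _).
  by rewrite ler_wpM2r ?mulr_ge0 ?(ltW D0) ?(ltW w0) // exprS ler_piMl // ltW.
apply: le_trans (_ : 2 * (d%:R * D * r ^+ d) <= _); last by rewrite ler_pM2l.
have -> : 2 * (d%:R * D * r ^+ d) = r ^+ d * (D * (2 * d%:R)) by ring.
by rewrite !ler_wpM2l // ltW.
Qed.

End GeometricRate.

(** * Approximation of the square root at a linear rate *)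

Section SquareRootOnUnitInterval.
Variable R : realType.
Implicit Types (p : {poly R}) (t x : R).

(** With [t = sin^2 th], the two components are [sin ((2n+1) th) / sin th] and
[cos ((2n+1) th) / cos th] as polynomials in [t]; the recursion is the rotation
by [2 th]. *)
Fixpoint odd_angle n : {poly R} * {poly R} :=
  if n is n'.+1 then
    let: (v, y) := odd_angle n' in
    ((1 - 'X *+ 2) * v + (1 - 'X) * y *+ 2, (1 - 'X *+ 2) * y - 'X * v *+ 2)
  else (1, 1).

Lemma odd_angle_size n :
  (size (odd_angle n).1 <= n.+1)%N /\ (size (odd_angle n).2 <= n.+1)%N.
Proof.
have szD (p q : {poly R}) m :
    (size p <= m)%N -> (size q <= m)%N -> (size (p + q)%R <= m)%N.
  by move=> pm qm; rewrite (leq_trans (size_polyD _ _)) // geq_max pm.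
have szX (p : {poly R}) m : (size p <= m)%N -> (size ('X * p)%R <= m.+1)%N.
  move=> pm; have [->|p0] := eqVneq p 0; first by rewrite mulr0 size_poly0.
  by rewrite mulrC size_mulX.
have szN (p : {poly R}) m : (size p <= m)%N -> (size (- p)%R <= m)%N.
  by rewrite size_polyN.
elim: n => [|n]; first by rewrite size_poly1.
rewrite /=; case: (odd_angle n) => v y /= [sv sy].
have [sv' sy'] := (leqW sv, leqW sy).
by split; rewrite !mulrBl !mul1r !mulr2n ?mulrDl !(szD, szN, szX).
Qed.

Lemma odd_angle0 t : (odd_angle 0).1.[t] = 1 /\ (odd_angle 0).2.[t] = 1.
Proof. by rewrite /= -polyC1 hornerC. Qed.

Lemma odd_angleS n t (V := (odd_angle n).1.[t]) (Y := (odd_angle n).2.[t]) :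
  (odd_angle n.+1).1.[t] = (1 - 2 * t) * V + 2 * (1 - t) * Y /\
  (odd_angle n.+1).2.[t] = (1 - 2 * t) * Y - 2 * t * V.
Proof.
rewrite /V /Y /=; case: (odd_angle n) => v y /=; rewrite -polyC1.
by rewrite !(hornerD, hornerN, hornerM, hornerMn, hornerX, hornerC); split; ring.
Qed.

Lemma odd_angle_circle n t :
  t * (odd_angle n).1.[t] ^+ 2 + (1 - t) * (odd_angle n).2.[t] ^+ 2 = 1.
Proof.
elim: n => [|n IH]; first by have [-> ->] := odd_angle0 t; ring.
by have [-> ->] := odd_angleS n t; rewrite -[RHS]IH; ring.
Qed.

(** Each rotation adds at most 2 to either component, since the circle identity
bounds [t V] and [(1 - t) Y] by 1. *)
Lemma odd_angle_upper n t : 0 <= t <= 1 ->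
  `|(odd_angle n).1.[t]| <= 2 * n%:R + 1 /\ `|(odd_angle n).2.[t]| <= 2 * n%:R + 1.
Proof.
move=> /andP[t0 t1]; elim: n => [|n].
  by have [-> ->] := odd_angle0 t; rewrite normr1 mulr0 add0r.
have := odd_angle_circle n t; have [-> ->] := odd_angleS n t.
set V := _.1.[t]; set Y := _.2.[t] => circ [hV hY].
rewrite -natr1; set m := n%:R in hV hY *; have m0 : 0 <= m by rewrite ler0n.
move: hV hY; rewrite !ler_norml => /andP[V1 V2] /andP[Y1 Y2].
have sqr_le (a b : R) : 0 <= a <= 1 -> a * b ^+ 2 <= 1 -> `|a * b| <= 1.
  move=> /andP[a0 a1] ab; rewrite -[leRHS]ger0_norm // -ler_sqr ?nnegrE //.
  rewrite !real_normK ?num_real // expr1n exprMn [a ^+ 2]expr2 -mulrA.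
  by rewrite mulr_ile1 // mulr_ge0 // sqr_ge0.
have sY : `|(1 - t) * Y| <= 1.
  apply: sqr_le; first by rewrite subr_ge0 t1 /= lerBlDr lerDl.
  by rewrite -[leRHS]circ lerDr mulr_ge0 ?sqr_ge0.
have sV : `|t * V| <= 1.
  apply: sqr_le; first by rewrite t0.
  by rewrite -[leRHS]circ lerDl mulr_ge0 ?sqr_ge0 ?subr_ge0.
move: sY sV; rewrite !ler_norml => /andP[a1 a2] /andP[b1 b2].
split; apply/andP; split; nra.
Qed.

(** Near [t = 0] the ratio [sin ((2n+1) th) / sin th] is still of order [n]. *)
Lemma odd_angle_lower N n t : (n <= N)%N -> 0 <= t ->
    36 * N.+1%:R ^+ 2 * t <= 1 ->
  n%:R + 1 <= (odd_angle n).1.[t] /\ 1 - 4 * n%:R ^+ 2 * t <= (odd_angle n).2.[t].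
Proof.
move=> + t0 tN; have N1 : 1 <= N.+1%:R :> R by rewrite ler1n.
have t1 : t <= 1 / 36 by nra.
elim: n => [_|n IH nN].
  by have [-> ->] := odd_angle0 t; rewrite add0r expr0n mulr0 mul0r subr0.
have t01 : 0 <= t <= 1 by rewrite t0; lra.
have := odd_angle_upper n t01.
have := IH (ltnW nN); have [-> ->] := odd_angleS n t.
set V := _.1.[t]; set Y := _.2.[t] => -[V1 Y1] []; rewrite !ler_norml.
move=> /andP[V2 V3] /andP[Y2 Y3].
rewrite -natr1; have nNR : n.+1%:R <= N.+1%:R :> R by rewrite ler_nat leqW.
move: nNR; rewrite -natr1; set m := n%:R in V1 V2 V3 Y1 Y2 Y3 *.
have m0 : 0 <= m by rewrite ler0n.
set M := N.+1%:R in tN N1 * => mM.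
have mt : (m + 1) ^+ 2 * t <= 1 / 36.
  have : (m + 1) ^+ 2 <= M ^+ 2 by rewrite ler_sqr ?nnegrE; lra.
  nra.
have tV : t * V <= t * (2 * m + 1) by rewrite ler_wpM2l.
have tY : t * Y <= t * (2 * m + 1) by rewrite ler_wpM2l.
have tm : t * (2 * m + 1) <= 1 / 18 by nra.
have Y4 : 8 / 9 <= Y by nra.
split; nra.
Qed.

End SquareRootOnUnitInterval.

Section OddAntiderivative.
Local Open Scope classical_set_scope.
Local Open Scope ring_scope.
Variable R : realType.
Implicit Types (W : {poly R}) (x a b : R).

(** The primitive of the even function [W(x^2)] is odd, hence equal to
[x P(x^2)]; multiplied once more by [x], it becomes a polynomial in [x^2]. *)
Lemma odd_antiderivative W m : (size W <= m)%N ->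
  exists2 P : {poly R}, (size P <= m)%N &
    exists2 J : {poly R}, forall x, J.[x] = x * P.[x ^+ 2] &
                          forall x, J^`().[x] = W.[x ^+ 2].
Proof.
move=> szW; pose c j := W`_j / (2 * j + 1)%:R.
exists (\poly_(j < m) c j); first exact: size_poly.
exists (\sum_(j < m) (c j)%:P * 'X^(2 * j + 1)) => x.
  rewrite horner_sum horner_poly mulr_sumr; apply: eq_bigr => j _.
  by rewrite hornerM hornerC hornerXn -exprM exprD expr1; ring.
rewrite (big_morph _ (@derivD R) (@deriv0 R)) horner_sum (horner_coef_wide _ szW).
apply: eq_bigr => j _.
rewrite deriv_mulC hornerM hornerC derivXn hornerMn hornerXn addn1 /= -exprM.
by rewrite /c addn1 -[X in _ * X = _]mulr_natl mulrA divfK ?pnatr_eq0.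
Qed.

Lemma poly_MVT (p : {poly R}) a b : a <= b ->
  exists2 c, a <= c <= b & p.[b] - p.[a] = p^`().[c] * (b - a).
Proof.
move=> ab; have [c] := @MVT_segment R (horner p) (horner p^`()) a b ab
  (fun x _ => is_derive_poly p x)
  (continuous_subspaceT (@continuous_horner R p)).
by rewrite in_itv /= => cab ->; exists c.
Qed.

(** The derivative [p' - 1 / x^2] is nonpositive by hypothesis. *)
Lemma poly_add_inv_decreasing (p : {poly R}) a b : 0 < a -> a <= b ->
    (forall c, a <= c <= b -> c ^+ 2 * p^`().[c] <= 1) ->
  p.[b] + b^-1 <= p.[a] + a^-1.
Proof.
move=> a0 ab pc.
have der x : a <= x ->
    is_derive x 1 (horner p + (fun y : R => y^-1)) (p^`().[x] - x ^- 2).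
  move=> ax; have x0 : x != 0 by rewrite gt_eqF // (lt_le_trans a0).
  apply: is_deriveD; apply: DeriveDef; first exact: (derivableV (f := id)).
  by rewrite (deriveV (f := id)) // derive_id scaler1.
have cont : {within `[a, b], continuous (horner p + (fun y : R => y^-1))}.
  apply: derivable_within_continuous => x; rewrite in_itv /= => /andP[ax _].
  by have [] := der x ax.
have der' x : x \in `]a, b[ -> is_derive x 1 (horner p + (fun y : R => y^-1))
    (p^`().[x] - x ^- 2) by rewrite in_itv /= => /andP[/ltW/der].
have [c cab E] := MVT_segment ab der' cont.
move: cab; rewrite in_itv /= => cab; rewrite -subr_le0.
have c0 : 0 < c by case/andP: cab => ac _; apply: lt_le_trans ac.
move: E; rewrite !fctE => ->; rewrite mulr_le0_ge0 ?subr_ge0 // subr_le0.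
by rewrite -div1r ler_pdivlMr ?exprn_gt0 // mulrC pc.
Qed.

End OddAntiderivative.

Section LinearRate.
Variable R : realType.

(** With [V(sin^2 th) = sin ((2n+1) th) / sin th] and [J' = V(x^2)^2], the
approximation of [x = sqrt t] is [x J(x) / J(1)]. Its error is
[x (J(1) - J(x)) / J(1)], where [J(1) - J(x) <= 1 / x - 1] because
[x^2 V(x^2)^2 <= 1], and [J(1)] is at least of order [n] because [V] is of order
[n] on an interval of length of order [1 / n]. *)
Lemma sqrt_approx_unit n : exists2 p : {poly R}, (size p <= (2 * n).+2)%N &
  forall t, 0 <= t <= 1 -> `|p.[t] - Num.sqrt t| <= 6 / n.+1%:R.
Proof.
set V := (odd_angle R n).1; set N : R := n.+1%:R.
have N1 : 1 <= N by rewrite /N ler1n.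
have szV : (size V <= n.+1)%N by have [] := odd_angle_size R n.
have szW : (size (V ^+ 2) <= (2 * n).+1)%N.
  rewrite (leq_trans (size_poly_exp_leq _ _)) // ltnS mulnC leq_mul //.
  by case: (size V) szV.
have [P szP [J JE J'E]] := odd_antiderivative szW.
have W0 x : 0 <= J^`().[x] by rewrite J'E horner_exp sqr_ge0.
have Jhom a b : a <= b -> J.[a] <= J.[b].
  move=> ab; have [c _ Jab] := poly_MVT J ab.
  by rewrite -subr_ge0 Jab mulr_ge0 // subr_ge0.
(* V(c^2) >= n + 1 for c in [0, s0], which alone makes J(1) of order n *)
pose s0 := (6 * N)^-1; have s00 : 0 < s0 by rewrite invr_gt0; lra.
have Js0 : N / 6 <= J.[s0].
  have [c /andP[c0 cs] Jc] := poly_MVT J (ltW s00).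
  have J0 : J.[0] = 0 by rewrite JE mul0r.
  move: Jc; rewrite J0 !subr0 => ->; rewrite J'E horner_exp.
  have [||lowV _] := @odd_angle_lower R n n (c ^+ 2) (leqnn _).
  - exact: sqr_ge0.
  - have -> : 36 * n.+1%:R ^+ 2 * c ^+ 2 = (6 * N * c) ^+ 2 by rewrite /N; ring.
    by rewrite expr_le1 ?mulr_ge0 // -ler_pdivlMl ?mulr1 //; lra.
  have {}lowV : N ^+ 2 <= V.[c ^+ 2] ^+ 2.
    by rewrite ler_sqr ?nnegrE -/V; move: lowV; rewrite natr1 -/N; lra.
  apply: le_trans (_ : N ^+ 2 * s0 <= _); last by rewrite ler_wpM2r // ltW.
  by rewrite /s0 le_eqVlt; apply/orP; left; apply/eqP; field; rewrite gt_eqF //; lra.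
have s01 : s0 <= 1 by rewrite /s0 invf_le1; lra.
have J1 : N / 6 <= J.[1] := le_trans Js0 (Jhom _ _ s01).
have J10 : 0 < J.[1] by apply: lt_le_trans J1; lra.
exists ('X * P * (J.[1]^-1)%:P).
  rewrite mulrC mul_polyC (leq_trans (size_scale_leq _ _)) //.
  have [->|P0] := eqVneq P 0; first by rewrite mulr0 size_poly0.
  by rewrite mulrC size_mulX.
move=> t /andP[t0 t1]; set x := Num.sqrt t.
have x0 : 0 <= x := sqrtr_ge0 t.
have x1 : x <= 1 by rewrite -sqrtr1 ler_wsqrtr.
have tE : t = x ^+ 2 by rewrite sqr_sqrtr.
have xJ : x * (J.[1] - J.[x]) <= 1.
  have [->|xN0] := eqVneq x 0; first by rewrite mul0r.
  have xp : 0 < x by rewrite lt_def xN0.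
  have := @poly_add_inv_decreasing R J x 1 xp x1.
  rewrite invr1 => dec.
  have {}dec : J.[1] - J.[x] <= x^-1 - 1.
    suff : J.[1] + 1 <= J.[x] + x^-1 by lra.
    apply: dec => c.
    move=> /andP[xc c1]; rewrite J'E horner_exp -(odd_angle_circle n (c ^+ 2)).
    rewrite lerDl mulr_ge0 ?sqr_ge0 // subr_ge0 expr_le1 //.
    exact: le_trans xc.
  apply: le_trans (ler_wpM2l x0 dec) _; rewrite mulrBr mulfV // mulr1; lra.
have -> : ('X * P * (J.[1]^-1)%:P).[t] = x * J.[x] / J.[1].
  by rewrite !hornerM hornerX hornerC [J.[x]]JE -tE {1}tE; ring.
have -> : x * J.[x] / J.[1] - x = - (x * (J.[1] - J.[x]) / J.[1]).
  by field; rewrite gt_eqF.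
rewrite normrN ger0_norm; last first.
  by rewrite divr_ge0 ?mulr_ge0 ?subr_ge0 ?Jhom // ltW.
rewrite ler_pdivrMr // -/N; apply: le_trans xJ _.
apply: le_trans (_ : 6 / N * (N / 6) <= _).
  have -> // : 6 / N * (N / 6) = 1 by field; rewrite gt_eqF //; lra.
by rewrite ler_wpM2l // divr_ge0 //; lra.
Qed.

Lemma sqrt_approx_linear d : (0 < d)%N -> exists2 p : {poly R}, (size p <= d.+1)%N &
  forall t, 0 <= t <= 1 -> `|p.[t] - Num.sqrt t| <= 12 / d%:R.
Proof.
case: d => // d _; have [p szp pE] := sqrt_approx_unit d./2.
exists p => [|t /pE /le_trans]; first by rewrite (leq_trans szp) // !ltnS; lia.
apply; have : d.+1%:R <= 2 * d./2.+1%:R :> R by rewrite -natrM ler_nat; lia.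
move=> dd; rewrite ler_pdivrMr ?ltr0n // mulrAC ler_pdivlMr ?ltr0n //; lra.
Qed.

End LinearRate.

(** * Attained optima and best approximations *)

Section LinearPrograms.
Variable R : realType.
Local Open Scope classical_set_scope.
Local Open Scope ring_scope.

Lemma scalar_continuous n (f : 'rV[R]_n -> R) : scalar f -> continuous f.
Proof.
move=> fL; have fE x : f x = \sum_j x 0 j * f (delta_mx 0 j).
  have f0 : f 0 = 0.
    by have := fL (-1) 0 0; rewrite scaler0 addr0 mulN1r addNr.
  have fD u v : f (u + v) = f u + f v by have := fL 1 u v; rewrite scale1r mul1r.
  have fZ a u : f (a *: u) = a * f u by have := fL a u 0; rewrite f0 !addr0.
  rewrite {1}[x]row_sum_delta (big_morph f fD f0).
  by apply: eq_bigr => j _; rewrite fZ.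
rewrite (funext fE); apply: continuous_big => [|j _].
  exact: add_continuous.
move=> x; apply: continuousM; [exact: coord_continuous|exact: cst_continuous].
Qed.

(** A feasible set given by arbitrarily many linear inequalities is closed, so
boundedness of one sublevel set suffices for the optimum to be reached. *)
Lemma linear_program_attained (I : Type) n (f : I -> 'rV[R]_n -> R) (b : I -> R)
    (c : 'rV[R]_n -> R) (x0 : 'rV[R]_n) (B : R) :
    (forall i, scalar (f i)) -> scalar c -> (forall i, b i <= f i x0) ->
    (forall x, (forall i, b i <= f i x) -> c x <= c x0 ->
       forall j, `|x 0 j| <= B) ->
  exists x, (forall i, b i <= f i x) /\
    forall y, (forall i, b i <= f i y) -> c x <= c y.
Proof.
move=> fL cL x0P bnd.
pose K := [set x | forall i, b i <= f i x] `&` [set x | c x <= c x0].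
have Kclosed : closed K.
  apply: closedI.
    rewrite (_ : [set _ | _] = \bigcap_(i in setT) (f i @^-1` [set y | b i <= y])).
      apply: closed_bigI => i _; apply: preimage_closed; last exact: closed_ge.
      by move=> x _; apply: scalar_continuous.
    by apply/seteqP; split => x /= H i; [move=> _; exact: H | exact: (H i Logic.I)].
  apply: (@preimage_closed _ _ c [set y | y <= c x0]); last exact: closed_le.
  by move=> x _; apply: scalar_continuous.
have Kcompact : compact K.
  have box : compact [set v : 'rV[R]_n | forall j, v ord0 j \in `[- B, B]].
    by apply: (@rV_compact _ _ (fun=> `[- B, B]%classic)) => _; exact: segment_compact.
  apply: subclosed_compact Kclosed box _ => x [xP cx] j /=.
  by rewrite in_itv /= -ler_norml; exact: bnd.
have K0 : K !=set0 by exists x0; split => //=.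
have cc : {within K, continuous c}.
  by apply: continuous_subspaceT => x; apply: scalar_continuous.
have [x xK xmin] := compact_EVT_min K0 Kcompact cc.
move: xK; rewrite inE => -[xP cx]; exists x; split=> // y yP.
have [cy|/ltW cy] := leP (c y) (c x0); last exact: le_trans cy.
by apply: xmin; rewrite inE; split.
Qed.

End LinearPrograms.

Section BestApproximation.
Variables (R : realType) (alpha : R).
Hypotheses (halpha0 : 0 <= alpha) (halpha1 : alpha < 1).
Local Open Scope classical_set_scope.
Local Open Scope ring_scope.
Implicit Types (p q : {poly R}) (t e : R).

Lemma sqrt_le1 t : alpha <= t <= 1 -> 0 <= Num.sqrt t <= 1.
Proof. by move=> /andP[_ t1]; rewrite sqrtr_ge0 -sqrtr1 ler_wsqrtr. Qed.

Lemma sqrt_error_ub p t :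
  alpha <= t <= 1 -> `|p.[t] - Num.sqrt t| <= sqrt_error alpha p.
Proof.
move=> tP; apply: ub_le_sup; last by exists t.
exists (\sum_(i < size p) `|p`_i| + 1) => _ /= [u uP <-].
have /andP[u0 u1] := uP; have {}u0 := le_trans halpha0 u0.
have /andP[s0 s1] := sqrt_le1 uP.
rewrite (le_trans (ler_normB _ _)) // [X in _ + X]ger0_norm // lerD //.
rewrite horner_coef (le_trans (ler_norm_sum _ _ _)) // ler_sum // => i _.
by rewrite normrM normrX ler_piMr // exprn_ile1 // ger0_norm.
Qed.

Lemma sqrt_error_le p e :
  (forall t, alpha <= t <= 1 -> `|p.[t] - Num.sqrt t| <= e) ->
  sqrt_error alpha p <= e.
Proof.
move=> pe; apply: ge_sup; first by eexists; exists 1; first by rewrite /= ltW //=.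
by move=> _ [t tP <-]; apply: pe.
Qed.

(** The best approximation minimises [e] over the pairs [(e, p)] such that
[|p(t) - sqrt t| <= e] on the whole interval. The values of [p] at [k + 1] nodes
bound its coefficients, by inverting a Vandermonde matrix. *)
Lemma best_sqrt_approx_exists k : exists p, is_best_sqrt_approx alpha k p.
Proof.
pose I := ({t : R | alpha <= t <= 1} * bool)%type.
pose pol (x : 'rV[R]_(1 + k.+1)) := rVpoly (rsubmx x).
pose c (x : 'rV[R]_(1 + k.+1)) := lsubmx x 0 0.
pose f (i : I) x := c x + (-1) ^+ i.2 * (pol x).[val i.1].
pose b (i : I) := (-1) ^+ i.2 * Num.sqrt (val i.1).
have feasP x : (forall i, b i <= f i x) <->
    (forall t, alpha <= t <= 1 -> `|(pol x).[t] - Num.sqrt t| <= c x).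
  split=> [xP t tP|xP [[t tP] s]].
    have := xP (exist _ t tP, true); have := xP (exist _ t tP, false).
    rewrite /b /f /= expr0 expr1 ler_norml => h0 h1; apply/andP; split; lra.
  have := xP t tP; rewrite ler_norml /b /f /= => /andP[h0 h1].
  by case: s; rewrite /= ?expr0 ?expr1; lra.
pose a : 'rV[R]_k.+1 := \row_j (alpha + (1 - alpha) * (j%:R / k.+1%:R)).
have kR : 0 < k.+1%:R :> R by rewrite ltr0n.
have aP j : alpha <= a 0 j <= 1.
  have j0 : 0 <= j%:R / k.+1%:R :> R by rewrite divr_ge0.
  have j1 : j%:R / k.+1%:R <= 1 :> R.
    by rewrite ler_pdivrMr // mul1r ler_nat ltnW.
  rewrite mxE lerDl mulr_ge0 ?subr_ge0 ?(ltW halpha1) //= -lerBrDl.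
  by rewrite ler_piMr // subr_ge0 ltW.
have Vunit : Vandermonde k.+1 a \in unitmx.
  rewrite unitmxE det_Vandermonde unitfE; apply/prodf_neq0 => i _.
  apply/prodf_neq0 => j ij; rewrite !mxE subr_eq0 gt_eqF // ltrD2l.
  by rewrite ltr_pM2l ?subr_gt0 // ltr_pM2r ?invr_gt0 // ltr_nat.
set V := Vandermonde _ _ in Vunit.
have valE x : rsubmx x = (\row_j (pol x).[a 0 j]) *m invmx V.
  apply: (canRL (mulmxK Vunit)); apply/rowP => j.
  rewrite !mxE (horner_coef_wide _ (size_poly _ _)); apply: eq_bigr => i _.
  by rewrite coef_rVpoly_ord !mxE.
pose x0 : 'rV[R]_(1 + k.+1) := row_mx 1%:M 0.
have c0 : c x0 = 1 by rewrite /c row_mxKl mxE eqxx.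
have p0 : pol x0 = 0 by rewrite /pol row_mxKr linear0.
have x0P i : b i <= f i x0.
  move: i; apply/feasP => t /sqrt_le1; rewrite p0 horner0 sub0r normrN c0 => /andP[s0 s1].
  by rewrite ger0_norm.
pose B := 1 + \sum_i \sum_j 2 * `|invmx V i j|.
have [|||x [xF xmin]] :=
    linear_program_attained (f := f) (b := b) (c := c) (B := B) _ _ x0P.
- move=> i r u v; rewrite /f /c /pol !linearP /= !mxE /= hornerD hornerZ; ring.
- by move=> r u v; rewrite /c linearP /= !mxE.
- move=> x xF; have /feasP xP := xF; rewrite c0 => cx1 j.
  have cx0 : 0 <= c x by apply: le_trans (normr_ge0 _) (xP 1 _); rewrite ltW /=.
  have B1 : 0 <= \sum_i \sum_j 2 * `|invmx V i j|.
    by apply: sumr_ge0 => i _; apply: sumr_ge0 => l _; rewrite mulr_ge0.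
  rewrite -[x]hsubmxK mxE; case: splitP => l _.
    rewrite (ord1 l) -/(c x) ger0_norm // /B; lra.
  rewrite valE mxE (le_trans (ler_norm_sum _ _ _)) // /B.
  apply: (@le_trans _ _ (\sum_i \sum_j 2 * `|invmx V i j|)); last by rewrite lerDr.
  apply: ler_sum => i _; rewrite (bigD1 l) //= ler_wpDr //.
    by apply: sumr_ge0 => m _; rewrite mulr_ge0.
  rewrite normrM ler_wpM2r // mxE.
  have := xP _ (aP i); have := sqrt_le1 (aP i); rewrite !ler_norml; lra.
have /feasP xP := xF.
exists (pol x); split; first exact: size_poly.
move=> q szq; apply: (le_trans (sqrt_error_le xP)).
pose y : 'rV[R]_(1 + k.+1) := row_mx (sqrt_error alpha q)%:M (poly_rV q).
have cy : c y = sqrt_error alpha q by rewrite /c row_mxKl mxE eqxx.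
rewrite -cy; apply: xmin; apply/feasP => t tP.
by rewrite /pol row_mxKr poly_rV_K // cy sqrt_error_ub.
Qed.

Lemma best_sqrt_approxP k : is_best_sqrt_approx alpha k (best_sqrt_approx alpha k).
Proof.
have [p pP] := best_sqrt_approx_exists k.
by rewrite /best_sqrt_approx; apply: (xgetPex 0 (ex_intro _ p pP)).
Qed.

Lemma best_sqrt_approx_le k p t : (size p <= k.+1)%N -> alpha <= t <= 1 ->
  `|(best_sqrt_approx alpha k).[t] - Num.sqrt t| <= sqrt_error alpha p.
Proof.
move=> szp tP; have [_ best] := best_sqrt_approxP k.
exact: le_trans (sqrt_error_ub _ tP) (best p szp).
Qed.

(** The end values of the square root are [1 - sqrt alpha] apart, so a constant
misses one of them by half of that. *)
Lemma constant_sqrt_error (a : R) :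
  (1 - Num.sqrt alpha) / 2 <= sqrt_error alpha a%:P.
Proof.
have tP : alpha <= alpha <= 1 by rewrite lexx ltW //=.
have t1 : alpha <= (1 : R) <= 1 by rewrite ltW /=.
have := sqrt_error_ub a%:P tP; have := sqrt_error_ub a%:P t1.
rewrite !hornerC sqrtr1 !ler_norml; lra.
Qed.

(** The zero polynomial errs by 1 at [t = 1], more than the best constant. *)
Lemma best_sqrt_approx0_neq0 : best_sqrt_approx alpha 0 != 0.
Proof.
have t1 : alpha <= (1 : R) <= 1 by rewrite ltW /=.
pose s := Num.sqrt alpha; pose q : {poly R} := ((1 + s) / 2)%:P.
have s0 : 0 <= s := sqrtr_ge0 _.
have s1 : s < 1 by rewrite /s -[ltRHS]sqrtr1 ltr_sqrt.
apply/eqP => b0.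
have := @best_sqrt_approx_le 0 q 1 (size_polyC_leq1 _) t1.
rewrite b0 horner0 sqrtr1 sub0r normrN normr1.
have : sqrt_error alpha q <= (1 - s) / 2.
  apply: sqrt_error_le => t tP; have /andP[_ st1] := sqrt_le1 tP.
  have st : s <= Num.sqrt t by rewrite ler_wsqrtr //; case/andP: tP.
  rewrite /q hornerC ler_norml; lra.
lra.
Qed.

(** The chord of the square root errs by at most [(1 - s)^2 / 4] with
[s = sqrt alpha], which is less than what a constant achieves. *)
Lemma best_sqrt_approx1_slope : (best_sqrt_approx alpha 1)`_1 != 0.
Proof.
have [szb best] := best_sqrt_approxP 1.
pose s := Num.sqrt alpha.
have s0 : 0 <= s := sqrtr_ge0 _.
have s1 : s < 1 by rewrite /s -[ltRHS]sqrtr1 ltr_sqrt.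
have s2 : s ^+ 2 = alpha by rewrite sqr_sqrtr.
pose r := (1 + s)^-1; have rs : r * (1 + s) = 1 by rewrite mulVf // gt_eqF //; lra.
have r0 : 0 < r by rewrite invr_gt0; lra.
pose q : {poly R} := r%:P * 'X + (s * r)%:P.
have szq : (size q <= 2)%N.
  by rewrite size_MXaddC; case: ifP => // _; rewrite ltnS size_polyC_leq1.
apply/eqP => b10.
have bE : best_sqrt_approx alpha 1 = ((best_sqrt_approx alpha 1)`_0)%:P.
  apply/polyP => -[|[|i]]; rewrite coefC //=.
  by rewrite nth_default // (leq_trans szb).
have := best q szq; rewrite bE; apply/negP; rewrite -ltNge.
apply: lt_le_trans (constant_sqrt_error _).
rewrite -/s; apply: (@le_lt_trans _ _ (((1 - s) / 2) ^+ 2)); last nra.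
apply: sqrt_error_le => t tP; have /andP[u0 u1] := sqrt_le1 tP.
set u := Num.sqrt t in u0 u1 *.
have st : s <= u by rewrite ler_wsqrtr //; case/andP: tP.
have tE : t = u ^+ 2 by rewrite sqr_sqrtr //; case/andP: tP => at1 _; apply: le_trans at1.
have -> : q.[t] - u = - (r * ((u - s) * (1 - u))).
  rewrite /q hornerD hornerM hornerX !hornerC tE.
  have -> : r * u ^+ 2 + s * r - u = r * u ^+ 2 + s * r - (r * (1 + s)) * u.
    by rewrite rs mul1r.
  ring.
rewrite normrN ger0_norm ?mulr_ge0 ?subr_ge0 // ?(ltW r0) //.
have r1 : r <= 1 by nra.
apply: le_trans (_ : (u - s) * (1 - u) <= _).
  by rewrite ler_piMl // mulr_ge0 // subr_ge0.
rewrite -subr_ge0.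
have -> : ((1 - s) / 2) ^+ 2 - (u - s) * (1 - u) = ((1 + s) / 2 - u) ^+ 2 by field.
exact: sqr_ge0.
Qed.

End BestApproximation.

(** * The group algebra and its regular representation *)

Section GroupAlgebraFacts.
Variables (C : numClosedFieldType) (gT : finGroupType).
Local Notation A := (group_algebra C gT).
Local Open Scope sesquilinear_scope.
Implicit Types f g : A.

Lemma gcoefN f x : gcoef (- f) x = - gcoef f x.
Proof. by rewrite -scaleN1r gcoefZ mulN1r. Qed.

Lemma gcoefB f g x : gcoef (f - g) x = gcoef f x - gcoef g x.
Proof. by rewrite gcoefD gcoefN. Qed.

Lemma gcoef0 x : gcoef (0 : A) x = 0.
Proof. by rewrite -(subrr 0) gcoefB subrr. Qed.

Lemma gcoef1 x : gcoef (1 : A) x = (x == 1%g)%:R.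
Proof. by rewrite galg_oneE gcoef_elt. Qed.

Lemma gcoef_mul f g z :
  gcoef (f * g) z = \sum_(x : gT) gcoef f x * gcoef g (x^-1 * z)%g.
Proof. by rewrite galg_mulE gcoefM. Qed.

Lemma gcoef_sum I (r : seq I) (P : pred I) (F : I -> A) x :
  gcoef (\sum_(i <- r | P i) F i) x = \sum_(i <- r | P i) gcoef (F i) x.
Proof.
elim/big_rec2: _ => [|i a b _ <-]; first exact: gcoef0.
by rewrite gcoefD.
Qed.

Lemma gcoef_star f x : gcoef (gstar f) x = (gcoef f x^-1%g)^*.
Proof. by rewrite {1}/gcoef ffunE. Qed.

Lemma gstarD f g : gstar (f + g) = gstar f + gstar g.
Proof. by apply: galgP => x; rewrite gcoef_star !gcoefD !gcoef_star rmorphD. Qed.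

Lemma gstarN f : gstar (- f) = - gstar f.
Proof. by apply: galgP => x; rewrite gcoef_star !gcoefN !gcoef_star rmorphN. Qed.

Lemma gstarZ (a : C) f : gstar (a *: f) = a^* *: gstar f.
Proof. by apply: galgP => x; rewrite gcoef_star !gcoefZ !gcoef_star rmorphM. Qed.

Lemma gstar_elt x : gstar (gelt x : A) = gelt x^-1%g.
Proof.
apply: galgP => z; rewrite gcoef_star !gcoef_elt rmorph_nat.
by rewrite (can2_eq (@invgK gT) (@invgK gT)).
Qed.

Lemma gstarM f g : gstar (f * g) = gstar g * gstar f.
Proof.
apply: galgP => z; rewrite gcoef_star !gcoef_mul rmorph_sum /=.
rewrite (reindex_inj (mulgI z^-1)%g) /=; apply: eq_bigr => x _.
by rewrite !gcoef_star rmorphM mulrC !invMg !invgK mulgK.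
Qed.

Lemma gelt_mul x y : gelt x * gelt y = gelt (x * y)%g :> A.
Proof.
apply: galgP => z; rewrite gcoef_mul (bigD1 x) //= big1 => [|w wNx].
  by rewrite !gcoef_elt eqxx mul1r addr0 (can2_eq (mulKVg x) (mulKg x)).
by rewrite gcoef_elt (negbTE wNx) mul0r.
Qed.

Lemma galg_sum_elt f : f = \sum_(x : gT) gcoef f x *: gelt x.
Proof.
apply: galgP => z; rewrite gcoef_sum (bigD1 z) //= big1 => [|w wNz].
  by rewrite gcoefZ gcoef_elt eqxx mulr1 addr0.
by rewrite gcoefZ gcoef_elt eq_sym (negbTE wNz) mulr0.
Qed.

End GroupAlgebraFacts.

Section RegularRepresentation.
Variables (C : numClosedFieldType) (gT : finGroupType).
Local Notation A := (group_algebra C gT).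
Local Open Scope sesquilinear_scope.
Implicit Types f g : A.

Lemma card_group_pred : #|gT|.-1.+1 = #|gT|.
Proof. by apply: prednK; apply/card_gt0P; exists 1%g. Qed.

Definition reg_elt (i : 'I_#|gT|.-1.+1) : gT :=
  enum_val (cast_ord card_group_pred i).

Lemma reg_elt_bij : bijective reg_elt.
Proof.
exists (fun x => cast_ord (esym card_group_pred) (enum_rank x)) => [i|x].
  by rewrite /reg_elt enum_valK cast_ordK.
by rewrite /reg_elt cast_ordKV enum_rankK.
Qed.

Lemma sum_reg_elt (F : gT -> C) : \sum_i F (reg_elt i) = \sum_x F x.
Proof. by rewrite [RHS](reindex reg_elt) //; apply: onW_bij reg_elt_bij. Qed.

(** Matrix of right multiplication by [f], acting on row vectors. *)
Definition regular_mx f : 'M[C]_#|gT|.-1.+1 :=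
  \matrix_(i, j) gcoef f ((reg_elt i)^-1 * reg_elt j)%g.

Fact regular_mx_is_linear : linear regular_mx.
Proof. by move=> a f g; apply/matrixP => i j; rewrite !mxE gcoefD gcoefZ. Qed.

Fact regular_mx_is_monoid_morphism : monoid_morphism regular_mx.
Proof.
split=> [|f g]; apply/matrixP => i j; rewrite !mxE.
  by rewrite gcoef1 -eq_mulVg1 (bij_eq reg_elt_bij).
under eq_bigr => k _ do rewrite !mxE.
rewrite gcoef_mul (reindex_inj (mulgI (reg_elt i)^-1)%g) /=.
rewrite (sum_reg_elt (fun x => gcoef f ((reg_elt i)^-1 * x)%g *
  gcoef g (x^-1 * reg_elt j)%g)).
by apply: eq_bigr => x _; rewrite invMg invgK -!mulgA mulKVg.
Qed.

HB.instance Definition _ :=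
  GRing.isLinear.Build C A _ _ regular_mx regular_mx_is_linear.
HB.instance Definition _ :=
  GRing.isMonoidMorphism.Build A _ regular_mx regular_mx_is_monoid_morphism.

Lemma regular_mx_star f : regular_mx (gstar f) = (regular_mx f)^t*.
Proof.
by apply/matrixP => i j; rewrite !mxE gcoef_star invMg invgK.
Qed.

Lemma regular_mx_star_representation : star_representation regular_mx.
Proof.
split=> [x|f]; last exact: regular_mx_star.
apply/unitarymxP; rewrite -regular_mx_star gstar_elt.
by rewrite -[LHS]rmorphM gelt_mul mulgV -galg_oneE rmorph1.
Qed.

(** Every row of the regular matrix of [f] is a rearrangement of the
coefficients of [f], so the diagonal of [M M^*] is constant. *)
Lemma regular_mx_norm f i :
  (regular_mx f *m (regular_mx f)^t*) i i = \sum_x `|gcoef f x| ^+ 2.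
Proof.
rewrite mxE (reindex_inj (mulgI (reg_elt i)^-1)%g) /=.
rewrite -(sum_reg_elt (fun x => `|gcoef f ((reg_elt i)^-1 * x)%g| ^+ 2)).
by apply: eq_bigr => j _; rewrite !mxE normCK.
Qed.

End RegularRepresentation.

Section SpectralBound.
Variables (C : numClosedFieldType) (gT : finGroupType).
Local Notation A := (group_algebra C gT).
Local Open Scope sesquilinear_scope.
Implicit Types (f : A) (p : {poly C}).

Lemma gstar_horner_alg p f :
    f = gstar f -> p \is a polyOver Num.real ->
  gstar (horner_alg f p) = horner_alg f p.
Proof.
move=> fE; have gstar1 : gstar (1 : A) = 1 by rewrite galg_oneE gstar_elt invg1.
have comm q : GRing.comm (horner_alg f q) f.
  rewrite /GRing.comm; transitivity (horner_alg f (q * 'X)).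
    by rewrite rmorphM /= horner_algX.
  by rewrite commr_polyX rmorphM /= horner_algX.
elim/poly_ind: p => [|p c IH] pR.
  by rewrite raddf0; apply: galgP => x; rewrite gcoef_star !gcoef0 conjC0.
have cR : c \is Num.real.
  by move/polyOverP: pR => /(_ 0%N); rewrite coefD coefMX coefC /= add0r.
have {}pR : p \is a polyOver Num.real.
  move/polyOverP: pR => pR; apply/polyOverP => i; move: (pR i.+1).
  by rewrite coefD coefMX coefC /= addr0.
rewrite rmorphD rmorphM /= horner_algX horner_algC gstarD gstarM gstarZ gstar1.
by rewrite (IH pR) -fE (conj_Creal cR) comm.
Qed.

Lemma horner_alg_eigenvector n (rho : {lrmorphism A -> 'M[C]_n.+1}) f
    (v : 'rV[C]_n.+1) a p :
  v *m rho f = a *: v -> v *m rho (horner_alg f p) = p.[a] *: v.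
Proof.
move=> vf; elim/poly_ind: p => [|p c IH].
  by rewrite [horner_alg f 0]raddf0 [rho 0]raddf0 mulmx0 horner0 scale0r.
rewrite raddfD /= rmorphM /= horner_algX horner_algC raddfD /= rmorphM linearZ /=.
rewrite rmorph1 mulmxDr mulmxA IH -scalemxAl vf -scalemxAr mulmx1 scalerA.
by rewrite -scalerDl !hornerE.
Qed.

(** The regular matrix of [f] is Hermitian with spectrum in [[a, b]], hence that
of [p(f)] has operator norm at most [e], and each of its rows lists the
coefficients of [p(f)]. *)
Lemma sum_sqr_horner_le a b e f p :
    gbetween a b f -> (forall t, a <= t <= b -> `|p.[t]| <= e) ->
  \sum_x `|gcoef (horner_alg f p) x| ^+ 2 <= e ^+ 2.
Proof.
move=> [fE spec] pe; set M := regular_mx f.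
have Mherm : M \is hermsymmx.
  by apply/is_hermitianmxP; rewrite expr0 scale1r -regular_mx_star -fE.
set U := spectralmx M; set D := spectral_diag M.
have Uu : U \is unitarymx := spectral_unitarymx M.
have UM : U *m M = diag_mx D *m U.
  have /hermitian_normalmx/orthomx_spectralP ME := Mherm.
  by rewrite {1}ME !mulmxA mulmxV ?mul1mx // spectral_unit.
have rowD (d : 'rV_#|gT|.-1.+1) j : row j (diag_mx d *m U) = d 0 j *: row j U.
  by rewrite row_mul row_diag_mx -scalemxAl -rowE.
have rowUM j : row j U *m M = D 0 j *: row j U.
  by rewrite -row_mul UM rowD.
have Dspec j : a <= D 0 j <= b.
  apply: (spec _ _ (regular_mx_star_representation C gT)).
  apply/eigenvalueP; exists (row j U); first exact: rowUM.
  apply/eqP => U0; have /unitarymxP/matrixP/(_ j j) := Uu.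
  move: U0 => /rowP U0; rewrite !mxE eqxx big1 => [/eqP|k _].
    by rewrite eq_sym oner_eq0.
  by have := U0 k; rewrite !mxE => ->; rewrite mul0r.
pose i0 : 'I_#|gT|.-1.+1 := ord0.
rewrite -(regular_mx_norm _ i0); set N := regular_mx _.
pose X := U^t* *m diag_mx (\row_j p.[D 0 j]).
have NE : N = X *m U.
  have UN : U *m N = diag_mx (\row_j p.[D 0 j]) *m U.
    apply/row_matrixP => j; rewrite row_mul rowD mxE.
    exact: (@horner_alg_eigenvector _ (regular_mx (C := C) (gT := gT)) _ _ _ _ (rowUM j)).
  by rewrite /X -mulmxA -UN mulmxA -invmx_unitary // mulVmx ?mul1mx ?spectral_unit.
have -> : N *m N^t* = X *m X^t*.
  by rewrite NE trmx_mul map_mxM mulmxA mulmxtVK.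
have UV : U^t* *m U = 1%:M by rewrite -invmx_unitary // mulVmx // spectral_unit.
have -> : e ^+ 2 = \sum_j `|U j i0| ^+ 2 * e ^+ 2.
  rewrite -mulr_suml; move/matrixP/(_ i0 i0): UV; rewrite !mxE eqxx.
  move=> UVi; rewrite -[LHS]mul1r -[X in X * _ = _]UVi; congr (_ * _).
  by apply: eq_bigr => j _; rewrite !mxE normCKC.
have XE j : X i0 j = (U j i0)^* * p.[D 0 j] by rewrite /X mul_mx_diag !mxE.
rewrite mxE; apply: ler_sum => j _; rewrite [(X^t*) j i0]mxE [X^T j i0]mxE.
rewrite -normCK XE normrM norm_conjC exprMn ler_wpM2l ?exprn_ge0 //.
by rewrite lerXn2r ?nnegrE ?(le_trans _ (pe _ (Dspec j))) ?pe.
Qed.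

End SpectralBound.

(** * Sums of squares *)

Section SumsOfSquares.
Variables (C : numClosedFieldType) (gT : finGroupType).
Local Notation A := (group_algebra C gT).
Local Open Scope sesquilinear_scope.
Implicit Types (f g h : A) (S : {set gT}).

Definition has_psd_gram S f : Prop :=
  exists Q : 'M[C]_#|S|, psdmx Q /\ f = gram_elt Q.

Lemma gram_eltD S (P Q : 'M[C]_#|S|) : gram_elt (P + Q) = gram_elt P + gram_elt Q.
Proof.
rewrite /gram_elt -big_split; apply: eq_bigr => i _ /=; rewrite -big_split.
by apply: eq_bigr => j _ /=; rewrite mxE scalerDl.
Qed.

Lemma gram_eltZ S (a : C) (Q : 'M[C]_#|S|) : gram_elt (a *: Q) = a *: gram_elt Q.
Proof.
rewrite /gram_elt scaler_sumr; apply: eq_bigr => i _; rewrite scaler_sumr.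
by apply: eq_bigr => j _; rewrite mxE scalerA.
Qed.

Lemma hermsymmxE m (Q : 'M[C]_m) : (Q \is hermsymmx) = (Q == Q^t*).
Proof.
apply/is_hermitianmxP/eqP; rewrite expr0 scale1r => {1}->; by rewrite ?map_trmx.
Qed.

Lemma has_psd_gramD S f g :
  has_psd_gram S f -> has_psd_gram S g -> has_psd_gram S (f + g).
Proof.
move=> [P [[Ph P0] ->]] [Q [[Qh Q0] ->]]; exists (P + Q); rewrite gram_eltD.
move: Ph Qh; rewrite !hermsymmxE => /eqP Ph /eqP Qh; split=> //; split=> [|v].
  by rewrite hermsymmxE linearD map_mxD /= -Ph -Qh.
by rewrite mulmxDr mulmxDl mxE addr_ge0.
Qed.

Lemma has_psd_gramZ S (a : C) f :
  0 <= a -> has_psd_gram S f -> has_psd_gram S (a *: f).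
Proof.
move=> a0 [Q [[Qh Q0] ->]]; exists (a *: Q); rewrite gram_eltZ.
move: Qh; rewrite !hermsymmxE => /eqP Qh; split=> //; split=> [|v].
  rewrite hermsymmxE linearZ /= map_mxZ /= -Qh; apply/eqP; congr (_ *: _).
  by rewrite conj_Creal // ger0_real.
by rewrite -scalemxAr -scalemxAl mxE mulr_ge0.
Qed.

Lemma has_psd_gram_square S h : gsupp h \subset S -> has_psd_gram S (gstar h * h).
Proof.
move=> hS; pose w : 'rV[C]_#|S| := \row_j gcoef h (enum_val j).
have hE : h = \sum_(j < #|S|) w 0 j *: gelt (enum_val j).
  rewrite [LHS]galg_sum_elt (bigID (mem S)) /= [X in _ + X]big1 ?addr0; last first.
    move=> x xS; suff /eqP -> : gcoef h x == 0 by rewrite scale0r.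
    by apply: contraNT xS => hx; apply: (fintype.subsetP hS); rewrite inE.
  rewrite [LHS]big_enum_val; apply: eq_bigr => j _; by rewrite mxE.
exists (w^t* *m w); split; first split.
- by rewrite hermsymmxE trmx_mul map_mxM /= trmxCK.
- move=> v; rewrite mulmxA -mulmxA -map_mxM -trmx_mul.
  by rewrite mxE big_ord1 !mxE -normCKC exprn_ge0.
rewrite /gram_elt {1}hE.
have -> : gstar (\sum_(j < #|S|) w 0 j *: gelt (enum_val j)) =
    \sum_(j < #|S|) (w 0 j)^* *: gelt (enum_val j)^-1%g :> A.
  elim/big_rec2: _ => [|i x y _ <-]; last by rewrite gstarD gstarZ gstar_elt.
  by apply: galgP => x; rewrite gcoef_star !gcoef0 conjC0.
rewrite mulr_suml; apply: eq_bigr => i _; rewrite {1}hE mulr_sumr.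
apply: eq_bigr => j _; rewrite -scalerAl -scalerAr gelt_mul scalerA.
by congr (_ *: _); rewrite !mxE big_ord1 !mxE.
Qed.

Lemma has_psd_gram0 S : has_psd_gram S 0.
Proof.
have -> : 0 = gstar 0 * 0 :> A by rewrite mulr0.
by apply: has_psd_gram_square; apply/fintype.subsetP => x; rewrite inE gcoef0 eqxx.
Qed.

(** With [u = c / |c|], the square of [x + u y] is
[2 + u x^-1 y + conj(u) y^-1 x]. *)
Lemma has_psd_gram_binomial S (c : C) x y : x \in S -> y \in S ->
  has_psd_gram S (`|c| *: 1 + 2^-1 *: (c *: gelt (x^-1 * y)%g
                                + c^* *: gelt (x^-1 * y)^-1%g) : A).
Proof.
move=> xS yS; have [->|c0] := eqVneq c 0.
  rewrite normr0 conjC0 !scale0r addr0 scaler0 addr0; exact: has_psd_gram0.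
have n0 : `|c| != 0 by rewrite normr_eq0.
pose u := c / `|c|; pose h : A := gelt x + u *: gelt y.
have cE : c = `|c| * u by rewrite /u mulrCA divff ?mulr1.
have uu : u^* * u = 1.
  by rewrite -normCKC /u normf_div normr_id divff // expr1n.
have hS : gsupp h \subset S.
  apply/fintype.subsetP => z; rewrite inE gcoefD gcoefZ !gcoef_elt.
  case: (z =P x) => [->//|_]; case: (z =P y) => [->//|_].
  by rewrite mulr0 addr0 eqxx.
have -> : `|c| *: 1 + 2^-1 *: (c *: gelt (x^-1 * y)%g + c^* *: gelt (x^-1 * y)^-1%g)
    = (2^-1 * `|c|) *: (gstar h * h) :> A.
  rewrite /h gstarD gstarZ !gstar_elt mulrDl !mulrDr -!scalerAl -!scalerAr !gelt_mul.
  rewrite !mulVg -galg_oneE invMg invgK [u^* *: u%:A]scalerA uu scale1r.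
  have cJ : c^* = `|c| * u^*.
    by rewrite {1}cE rmorphM /= [X in X * _]conj_Creal // normr_real.
  rewrite cJ; set n := `|c|; rewrite [in LHS]cE -/n; apply: galgP => z.
  by rewrite !(gcoefD, gcoefZ); field.
apply: has_psd_gramZ; first by rewrite mulr_ge0 ?invr_ge0 ?ler0n.
exact: has_psd_gram_square.
Qed.

Lemma has_psd_gram_sum S (F : gT -> A) :
  (forall x, has_psd_gram S (F x)) -> has_psd_gram S (\sum_x F x).
Proof.
move=> FS; elim/big_rec: _ => [|x f _ fS]; first exact: has_psd_gram0.
exact: has_psd_gramD.
Qed.

(** The term [c z] of [g] and its mirror image [conj(c) z^-1] are completed by
[|c|] to the square of a binomial; [g = g^*] makes the sum over [z] of the
halves [(c z + conj(c) z^-1) / 2] equal to [g]. *)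
Lemma has_psd_gram_l1 S g : g = gstar g ->
    (forall z, z \in gsupp g ->
       exists x y, [/\ x \in S, y \in S & z = (x^-1 * y)%g]) ->
  has_psd_gram S (g + (\sum_x `|gcoef g x|) *: 1).
Proof.
move=> gE gS.
have -> : g + (\sum_x `|gcoef g x|) *: 1 = \sum_x (`|gcoef g x| *: 1 +
    2^-1 *: (gcoef g x *: gelt x + (gcoef g x)^* *: gelt x^-1%g)).
  rewrite big_split /= -scaler_suml addrC; congr (_ + _).
  rewrite -scaler_sumr big_split /= -galg_sum_elt.
  rewrite [X in _ + X](_ : _ = g); last first.
    rewrite [RHS]galg_sum_elt (reindex_inj (@invg_inj gT)) /=.
    by apply: eq_bigr => x _; rewrite invgK -gcoef_star -gE.
  by apply: galgP => x; rewrite gcoefZ gcoefD; field.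
apply: has_psd_gram_sum => z; have [/gS [x [y [xS yS ->]]]|] := boolP (z \in gsupp g).
  exact: has_psd_gram_binomial.
rewrite inE negbK => /eqP ->.
rewrite normr0 conjC0 !scale0r addr0 scaler0 addr0; exact: has_psd_gram0.
Qed.

End SumsOfSquares.

(** * The certificate and the bands *)

Section GramCertificate.
Variables (C : numClosedFieldType) (gT : finGroupType).
Local Notation A := (group_algebra C gT).
Implicit Types (f : A) (S : {set gT}).

Lemma sqr_sum_le_card (T : {set gT}) (a : gT -> C) :
    (forall x, 0 <= a x) ->
  (\sum_(x in T) a x) ^+ 2 <= #|T|%:R * \sum_(x in T) a x ^+ 2.
Proof.
move=> a0; set s := \sum_(x in T) a x; set q := \sum_(x in T) _; set n := #|T|%:R.
have s0 : 0 <= s by apply: sumr_ge0.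
have [T0|n0] := eqVneq #|T| 0.
  by rewrite /n T0 mul0r /s (cards0_eq T0) big_set0 expr0n.
have npos : 0 < n by rewrite /n ltr0n lt0n.
have : 0 <= \sum_(x in T) (n * a x - s) ^+ 2.
  apply: sumr_ge0 => x _; rewrite real_exprn_even_ge0 // rpredB // ?rpredM //;
  by apply: ger0_real => //; rewrite ltW.
have -> : \sum_(x in T) (n * a x - s) ^+ 2 = n * (n * q - s ^+ 2).
  under eq_bigr => x _ do rewrite sqrrB exprMn.
  rewrite big_split sumrB /= -mulr_sumr -/q sumrMnl -mulr_suml -mulr_sumr -/s.
  by rewrite sumr_const -[s ^+ 2 *+ _]mulr_natl -/n; ring.
by rewrite pmulr_rge0 // subr_ge0.
Qed.

Lemma gsupp_sum (g : A) (F : C -> C) : F 0 = 0 ->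
  \sum_x F (gcoef g x) = \sum_(x in gsupp g) F (gcoef g x).
Proof.
move=> F0; rewrite [LHS](bigID (mem (gsupp g))) /= [X in _ + X]big1 ?addr0 // => x.
by rewrite inE negbK => /eqP ->.
Qed.

(** The certificate is [f + l = p(f)^* p(f) + (g + l)] with [g = f - p(f)^2]:
the l^1-norm [l] of [g] makes [g + l] a sum of squares of binomials, and it
exceeds the l^2-norm by at most a factor, the square root of the size of the
support. *)
Lemma gram_certificate a b f (p : {poly C}) S e (m : nat) :
    gbetween a b f -> p \is a polyOver Num.real ->
    gsupp (horner_alg f p) \subset S -> gsupp f \subset S -> 1%g \in S ->
    (forall t, a <= t <= b -> `|t - p.[t] ^+ 2| <= e) ->
    (#|gsupp (horner_alg f ('X - p ^+ 2))| <= m)%N ->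
  exists l, [/\ 0 <= l, l ^+ 2 <= m%:R * e ^+ 2 & has_psd_gram S (f + l *: 1)].
Proof.
move=> fab pR PS fS S1 pe cardm; have fE : f = gstar f by case: fab.
set P := horner_alg f p in PS; set g := horner_alg f _ in cardm.
have PE : gstar P = P by apply: gstar_horner_alg.
have gE : g = f - gstar P * P.
  by rewrite PE /g rmorphB /= horner_algX rmorphXn.
exists (\sum_x `|gcoef g x|); split.
- by apply: sumr_ge0.
- rewrite (@gsupp_sum g (fun c => `|c|)) ?normr0 //.
  apply: le_trans (sqr_sum_le_card _ _) _ => //.
  rewrite -(@gsupp_sum g (fun c => `|c| ^+ 2)) ?normr0 ?expr0n //.
  apply: ler_pM; rewrite ?ler_nat ?ler0n //.
    by apply: sumr_ge0 => x _; rewrite exprn_ge0.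
  by apply: sum_sqr_horner_le fab _ => t tab; rewrite !hornerE pe.
have -> : f + (\sum_x `|gcoef g x|) *: 1 =
    gstar P * P + (g + (\sum_x `|gcoef g x|) *: 1).
  by set l := \sum_x _; rewrite gE addrA [gstar P * P + (_ - _)]addrC subrK.
apply: has_psd_gramD; first exact: has_psd_gram_square.
apply: has_psd_gram_l1 => [|z].
  by rewrite gE gstarD gstarN gstarM -fE !PE.
rewrite inE gE gcoefB => zg.
have [fz0|fz] := eqVneq (gcoef f z) 0; last first.
  exists 1%g, z; rewrite invg1 mul1g; split=> //.
  by apply: (fintype.subsetP fS); rewrite inE.
have {}zg : gcoef (gstar P * P) z != 0.
  by move: zg; rewrite fz0 sub0r oppr_eq0.
have [x xP] : exists x, gcoef (gstar P) x * gcoef P (x^-1 * z)%g != 0.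
  apply/existsP; apply: contraNT zg; rewrite negb_exists => /forallP P0.
  by rewrite gcoef_mul big1 // => x _; have := P0 x; rewrite negbK => /eqP.
move: xP; rewrite mulf_eq0 negb_or gcoef_star conjC_eq0 => /andP[Px Py].
exists x^-1%g, (x^-1 * z)%g; rewrite invgK mulKVg; split=> //;
  by apply: (fintype.subsetP PS); rewrite inE.
Qed.

End GramCertificate.

Section Bandwidths.
Variables (C : numClosedFieldType) (gT : finGroupType).
Local Notation A := (group_algebra C gT).

(** The sets [B i] filter the group, so the support of [f^n] lies in
[B (n k)] if that of [f] lies in [B k]. *)
Lemma gsupp_horner_alg (B : nat -> {set gT}) (f : A) k (p : {poly C}) n :
    (forall i, 1%g \in B i) ->
    (forall i j x y, x \in B i -> y \in B j -> (x * y)%g \in B (i + j)%N) ->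
    gsupp f \subset B k -> (size p <= n.+1)%N ->
  gsupp (horner_alg f p) \subset B (n * k)%N.
Proof.
move=> B1 BM fB; elim/poly_ind: p n => [|p c IH] n szp.
  by rewrite raddf0; apply/fintype.subsetP => x; rewrite inE gcoef0 eqxx.
rewrite rmorphD rmorphM /= horner_algX horner_algC.
apply/fintype.subsetP => z; rewrite inE gcoefD gcoefZ gcoef1.
case: (z =P 1%g) => [-> //|_]; rewrite mulr0 addr0.
move: szp; rewrite size_MXaddC.
have [->|p0] := eqVneq p 0; first by rewrite raddf0 mul0r gcoef0 eqxx.
rewrite ltnS; case: n => [|n szp].
  by rewrite leqn0 size_poly_eq0 (negbTE p0).
rewrite gcoef_mul; apply: contraR => zB; apply/eqP; apply: big1 => x _.
apply/eqP; rewrite mulf_eq0; apply: contraR zB; rewrite negb_or => /andP[px fx].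
rewrite -(mulKVg x z) mulSn addnC; apply: BM.
  by apply: (fintype.subsetP (IH n szp)); rewrite inE.
by apply: (fintype.subsetP fB); rewrite inE.
Qed.

End Bandwidths.

Section Bands.
Variable gT : finGroupType.
Implicit Types x y s t : gT.
Local Open Scope group_scope.

(** An exponent [r > N], for which [N - r] truncates to 0, is first reduced
modulo [N]. *)
Lemma cyclic_bandP N y k x : (0 < N)%N -> y ^+ N = 1 ->
  reflect (exists2 r, (r <= k)%N & x = y ^+ r \/ x = y ^- r)
          (x \in cyclic_band N y k).
Proof.
move=> N0 yN; have yNB r : (r <= N)%N -> y ^+ (N - r) = y ^- r.
  by move=> rN; apply/eqP; rewrite eq_sym eq_invg_mul -expgD addnC subnK // yN.
apply: (iffP idP) => [|[r rk]].
  rewrite inE => /orP[] /imsetP[[r rk] _ ->] /=; first by exists r => //; left.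
  have [rN|/ltnW Nr] := leqP r N; first by exists r; [|right; rewrite yNB].
  by exists 0%N => //; left; rewrite (eqP Nr).
case=> ->; rewrite inE; apply/orP.
  by left; apply/imsetP; exists (Ordinal (rk : (r < k.+1)%N)).
right; have rNk : (r %% N < k.+1)%N by rewrite ltnS (leq_trans (leq_mod _ _)).
apply/imsetP; exists (Ordinal rNk) => //=.
rewrite yNB ?(ltnW (ltn_pmod _ _)) //; congr _^-1.
by rewrite {1}(divn_eq r N) expgD mulnC expgM yN expg1n mul1g.
Qed.

Lemma cyclic_band1 N y k : (0 < N)%N -> y ^+ N = 1 -> 1 \in cyclic_band N y k.
Proof. by move=> N0 yN; apply/cyclic_bandP => //; exists 0%N => //; left. Qed.

Lemma cyclic_bandV N y k x : (0 < N)%N -> y ^+ N = 1 ->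
  x \in cyclic_band N y k -> x^-1 \in cyclic_band N y k.
Proof.
move=> N0 yN /(cyclic_bandP _ _ N0 yN)[r rk xE].
apply/cyclic_bandP => //; exists r => //.
by case: xE => ->; [right | left; rewrite invgK].
Qed.

Lemma cyclic_bandM N y i j u v : (0 < N)%N -> y ^+ N = 1 ->
  u \in cyclic_band N y i -> v \in cyclic_band N y j ->
  u * v \in cyclic_band N y (i + j).
Proof.
move=> N0 yN /(cyclic_bandP _ _ N0 yN)[r ri uE] /(cyclic_bandP _ _ N0 yN)[q qj vE].
apply/cyclic_bandP => //.
have mixed a b : exists2 c, (c <= a + b)%N &
    y ^+ a * y ^- b = y ^+ c \/ y ^+ a * y ^- b = y ^- c.
  have [ba|/ltnW ab] := leqP b a.
    exists (a - b)%N; first by rewrite (leq_trans (leq_subr _ _)) ?leq_addr.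
    by left; rewrite -{1}(subnK ba) expgD mulgK.
  exists (b - a)%N; first by rewrite (leq_trans (leq_subr _ _)) ?leq_addl.
  by right; rewrite -{1}(subnK ab) expgD invMg mulgA mulgV mul1g.
have comm a b : y ^- a * y ^+ b = y ^+ b * y ^- a.
  by apply: (mulgI (y ^+ a)); rewrite mulKVg mulgA -expgD addnC expgD mulgK.
have rq : (r + q <= i + j)%N by rewrite leq_add.
case: uE => ->; case: vE => ->.
- by exists (r + q)%N => //; left; rewrite expgD.
- by have [c cle cE] := mixed r q; exists c => //; rewrite (leq_trans cle).
- have [c cle cE] := mixed q r; exists c; rewrite ?comm //.
  by rewrite (leq_trans cle) // addnC.
by exists (r + q)%N => //; right; rewrite addnC expgD invMg.
Qed.

(** The exponents range over [[-k, k]]: both halves contain the identity. *)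
Lemma card_cyclic_band N y k : (0 < N)%N -> y ^+ N = 1 ->
  (#|cyclic_band N y k| <= 2 * k + 1)%N.
Proof.
move=> N0 yN; rewrite /cyclic_band cardsU.
set X := [set _ | r : _]; set Y := [set y ^+ (N - _) | r : _].
have I1 : (0 < #|X :&: Y|)%N.
  apply/card_gt0P; exists 1; rewrite inE; apply/andP; split; apply/imsetP.
    by exists ord0.
  by exists ord0 => //=; rewrite subn0.
have cX : (#|X| <= k.+1)%N by rewrite -[leqRHS]card_ord; apply: leq_imset_card.
have cY : (#|Y| <= k.+1)%N by rewrite -[leqRHS]card_ord; apply: leq_imset_card.
move: I1 cX cY; move: #|X| #|Y| #|X :&: Y| => a b c; lia.
Qed.

Lemma dihedral_conj s t a : t ^+ 2 = 1 -> (s * t) ^+ 2 = 1 ->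
  t * s ^+ a = s ^- a * t.
Proof.
move=> t2 st2; have tts : t * s = s^-1 * t.
  apply: (mulgI s); rewrite mulKVg; apply: (mulIg t).
  by move: t2 st2; rewrite !expgS !expg0 !mulg1 => -> <-; rewrite !mulgA.
elim: a => [|a IH]; first by rewrite expg0 invg1 mulg1 mul1g.
by rewrite [in LHS]expgSr mulgA IH -mulgA tts mulgA -invMg -expgS.
Qed.

Lemma dihedral_bandM N s t i j u v :
    (0 < N)%N -> s ^+ N = 1 -> t ^+ 2 = 1 -> (s * t) ^+ 2 = 1 ->
  u \in dihedral_band N s t i -> v \in dihedral_band N s t j ->
  u * v \in dihedral_band N s t (i + j).
Proof.
move=> N0 sN t2 st2.
have tB x k : x \in cyclic_band N s k -> t * x = x^-1 * t.
  move=> /(cyclic_bandP _ _ N0 sN)[r _ [] ->]; first exact: dihedral_conj.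
  by rewrite invgK; apply: (mulIg (s ^+ r)); rewrite mulgKV -mulgA dihedral_conj // mulKVg.
have M a b x y := @cyclic_bandM N s a b x y N0 sN.
have V k x := @cyclic_bandV N s k x N0 sN.
have tt : t * t = 1 by rewrite -t2 expgS expg1.
have inD k x : (x \in dihedral_band N s t k) =
    (x \in cyclic_band N s k) || (x \in [set z * t | z in cyclic_band N s k]).
  by rewrite finset.in_setU.
rewrite !inD => /orP[uB|/imsetP[u' uB ->]] /orP[vB|/imsetP[v' vB ->]].
- by rewrite M.
- by apply/orP; right; apply/imsetP; exists (u * v'); rewrite ?mulgA ?M.
- apply/orP; right; apply/imsetP; exists (u' * v^-1); first by apply: M => //; apply: V.
  by rewrite -mulgA (tB _ _ vB) mulgA.
apply/orP; left; rewrite -mulgA [t * _]mulgA (tB _ _ vB) -mulgA tt mulg1.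
by apply: M => //; apply: V.
Qed.

Lemma card_dihedral_band N s t k : (0 < N)%N -> s ^+ N = 1 ->
  (#|dihedral_band N s t k| <= 4 * k + 2)%N.
Proof.
move=> N0 sN; rewrite /dihedral_band cardsU.
have cB := card_cyclic_band k N0 sN.
set X := cyclic_band N s k in cB *; set Y := [set _ | _ in _].
have cY : (#|Y| <= #|X|)%N by apply: leq_imset_card.
move: cB cY; move: #|X| #|Y| #|X :&: Y| => a b c; lia.
Qed.

End Bands.

(** * The smallest shift *)

Section MinimalShift.
Variables (R : realType) (gT : finGroupType).
Local Notation C := (R[i]%C : numClosedFieldType).
Local Notation A := (group_algebra C gT).
Local Open Scope sesquilinear_scope.
Local Open Scope complex_scope.
Implicit Types (f : A) (S : {set gT}).

(** A real-linear bijection from all real matrices to the Hermitian ones, so that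
psd matrices are described by real coordinates. *)
Definition hermitian_of_real m (X : 'M[R]_m) : 'M[C]_m :=
  \matrix_(i, j) ((X i j + X j i) +i* (X i j - X j i)).

Lemma hermitian_of_real_linear m (a : R) (X Y : 'M[R]_m) :
  hermitian_of_real (a *: X + Y) =
  a%:C *: hermitian_of_real X + hermitian_of_real Y.
Proof.
by apply/matrixP => i j; rewrite !mxE; apply/eqP; rewrite eq_complex /=;
  apply/andP; split; apply/eqP; ring.
Qed.

Lemma hermitian_of_real_herm m (X : 'M[R]_m) : hermitian_of_real X \is hermsymmx.
Proof.
rewrite hermsymmxE; apply/eqP/matrixP => i j; rewrite !mxE /=.
by apply/eqP; rewrite eq_complex /= opprB addrC !eqxx.
Qed.

Lemma hermitian_of_real_surj m (Q : 'M[C]_m) : Q \is hermsymmx ->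
  exists X, Q = hermitian_of_real X.
Proof.
rewrite hermsymmxE => /eqP QE.
exists (\matrix_(i, j) ((complex.Re (Q i j) + complex.Im (Q i j)) / 2)).
apply/matrixP => i j; rewrite !mxE.
have -> : Q j i = (Q i j)^*%C by rewrite {1}QE !mxE.
by case: (Q i j) => u v; apply/eqP; rewrite eq_complex /=; apply/andP; split;
  apply/eqP; field.
Qed.

Lemma quadratic_form_pair (K : numClosedFieldType) m (Q : 'M[K]_m) i j (u : K) :
  let v := delta_mx i 0 + u *: delta_mx j 0 : 'cV[K]_m in
  (v^t* *m Q *m v) 0 0 =
    Q i i + u * Q i j + (Num.conj u * Q j i + Num.conj u * u * Q j j).
Proof.
have E a b :
    ((delta_mx a 0 : 'cV[K]_m)^t* *m Q *m (delta_mx b 0 : 'cV[K]_m)) 0 0 = Q a b.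
  by rewrite trmx_delta map_delta_mx -rowE -colE !mxE.
rewrite /=; have -> : (delta_mx i 0 + u *: delta_mx j 0 : 'cV[K]_m)^t* =
    (delta_mx i 0 : 'cV[K]_m)^t* + Num.conj u *: (delta_mx j 0 : 'cV[K]_m)^t*.
  by apply/matrixP => a b; rewrite !mxE rmorphD rmorphM.
rewrite mulmxDr !mulmxDl -!scalemxAr -!scalemxAl.
have addE (M N : 'M[K]_1) : (M + N) 0 0 = M 0 0 + N 0 0 by rewrite mxE.
have scaleE a (M : 'M[K]_1) : (a *: M) 0 0 = a * M 0 0 by rewrite mxE.
by rewrite !(addE, scaleE) !E; ring.
Qed.

Lemma gcoef_gram1 (K : numClosedFieldType) S (Q : 'M[K]_#|S|) :
  gcoef (gram_elt Q) 1%g = \tr Q.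
Proof.
rewrite /gram_elt gcoef_sum; apply: eq_bigr => i _; rewrite gcoef_sum (bigD1 i) //=.
rewrite big1 => [|j ji]; rewrite gcoefZ gcoef_elt.
  by rewrite mulVg eqxx mulr1 addr0.
rewrite eq_sym -eq_mulVg1 (inj_eq enum_val_inj) eq_sym (negbTE ji) mulr0 //.
Qed.

Lemma complex_Re_scalar (a : R) (w z : C) :
  complex.Re (a%:C * w + z) = a * complex.Re w + complex.Re z.
Proof. by case: w => ? ?; case: z => ? ? /=; rewrite mul0r subr0. Qed.

Lemma complex_Im_scalar (a : R) (w z : C) :
  complex.Im (a%:C * w + z) = a * complex.Im w + complex.Im z.
Proof. by case: w => ? ?; case: z => ? ? /=; rewrite mul0r addr0. Qed.

Lemma hermitian_form_real (K : numClosedFieldType) m (Q : 'M[K]_m) (v : 'cV[K]_m) :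
  Q \is hermsymmx -> (v^t* *m Q *m v) 0 0 \is Num.real.
Proof.
rewrite hermsymmxE => /eqP QE; apply/CrealP.
have -> : Num.conj ((v^t* *m Q *m v) 0 0) = ((v^t* *m Q *m v)^t*) 0 0.
  by rewrite [RHS]mxE [in RHS]mxE.
by rewrite !trmx_mul !map_mxM /= trmxCK -QE mulmxA.
Qed.

(** With [I] the imaginary unit, testing the form on [e_i + s (1 - I) e_j] for
[s = 1] and [s = -1] bounds [4 |X i j|] by the diagonal, which the trace bounds in
turn. *)
Lemma hermitian_of_real_bounded m (X : 'M[R]_m) (T : R) :
    psdmx (hermitian_of_real X) ->
    complex.Re (\tr (hermitian_of_real X)) <= T ->
  forall i j, `|X i j| <= T.
Proof.
move=> [_ Q0] trT; set Q := hermitian_of_real X in Q0 trT.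
have pair i j (s : R) : 0 <= X i i + X i i +
    (s ^+ 2 + s ^+ 2) * (X j j + X j j) + 4 * (s * X i j).
  have := Q0 (delta_mx i 0 + (s -i* s) *: delta_mx j 0).
  rewrite quadratic_form_pair !mxE lecE /= => /andP[_ ge0].
  by apply: le_trans ge0 _; rewrite le_eqVlt; apply/orP; left; apply/eqP; ring.
have diag i : 0 <= X i i by have := pair i i 0; lra.
have diagT i : X i i + X i i <= T.
  apply: le_trans trT; rewrite raddf_sum /= (bigD1 i) //= !mxE /= lerDl.
  by apply: sumr_ge0 => j _; rewrite !mxE /= addr_ge0.
move=> i j; rewrite ler_norml; have := pair i j 1; have := pair i j (-1).
have := diag i; have := diag j; have := diagT i; have := diagT j.
by rewrite sqrrN expr1n => ? ? ? ? ? ?; apply/andP; split; lra.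
Qed.

(** The shifts are [tr Q - C_f(1)] for the psd matrices [Q] in an affine space,
so this is a linear program over the psd cone, on which a bound of the trace
bounds every entry. *)
Lemma gram_shift_min f S :
    (exists l : R, 0 <= l /\ has_psd_gram S (f + l%:C *: 1)) ->
  exists2 l : R, 0 <= l /\ has_psd_gram S (f + l%:C *: 1) &
    forall l' : R, 0 <= l' -> has_psd_gram S (f + l'%:C *: 1) -> l <= l'.
Proof.
move=> [l0 [l0_ge0 l0P]]; set m := #|S|.
pose Q (x : 'rV[R]_(m * m)) : 'M[C]_m := hermitian_of_real (vec_mx x).
have QL a x y : Q (a *: x + y) = a%:C *: Q x + Q y.
  by rewrite /Q linearP hermitian_of_real_linear.
pose G x z := gcoef (gram_elt (Q x)) z.
have GL z a x y : G (a *: x + y) z = a%:C * G x z + G y z.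
  by rewrite /G QL gram_eltD gram_eltZ gcoefD gcoefZ.
pose c x := complex.Re (G x 1%g).
pose I := ('cV[C]_m + (gT * bool + gT * bool))%type.
(* positivity, then imaginary parts, then real parts: at the identity the real
   part is only bounded below, which leaves the shift free *)
pose F (i : I) x := match i with
  | inl v => complex.Re ((v^t* *m Q x *m v) 0 0)
  | inr (inl (z, s)) => (-1) ^+ s * complex.Im (G x z)
  | inr (inr (z, s)) => if (z == 1%g) && s then 0 else (-1) ^+ s * complex.Re (G x z)
  end.
pose b (i : I) := match i with
  | inl v => 0
  | inr (inl (z, s)) => (-1) ^+ s * complex.Im (gcoef f z)
  | inr (inr (z, s)) => if (z == 1%g) && s then 0
                        else (-1) ^+ s * complex.Re (gcoef f z)
  end.
pose shift x := c x - complex.Re (gcoef f 1%g).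
have feasP x : (forall i, b i <= F i x) <->
    0 <= shift x /\ (psdmx (Q x) /\ f + (shift x)%:C *: 1 = gram_elt (Q x)).
  have Qherm : Q x \is hermsymmx := hermitian_of_real_herm _.
  split=> [xF|[sx [[_ Q0] fE]] i].
    have ImE z : complex.Im (G x z) = complex.Im (gcoef f z).
      have := xF (inr (inl (z, true))); have := xF (inr (inl (z, false))).
      rewrite /= expr0 expr1; lra.
    have ReE z : z != 1%g -> complex.Re (G x z) = complex.Re (gcoef f z).
      move=> /negbTE z1.
      have := xF (inr (inr (z, true))); have := xF (inr (inr (z, false))).
      rewrite /= z1 /= expr0 expr1; lra.
    split.
      by have := xF (inr (inr (1%g, false))); rewrite /= andbF expr0 !mul1r subr_ge0.
    split; first split=> // v.
      have := xF (inl v); rewrite /= => Re0; rewrite lecE /= Re0 andbT.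
      have := hermitian_form_real v Qherm.
      by move=> /complex_realP[k ->]; rewrite eqxx.
    apply: galgP => z; rewrite gcoefD gcoefZ gcoef1.
    have [->|z1] := eqVneq z 1%g.
      have := ImE 1%g; rewrite /shift /c -/(G x 1%g).
      case: (gcoef f 1%g) (G x 1%g) => [u v] [u' v'] /= ->.
      by apply/eqP; rewrite eq_complex /=; apply/andP; split; apply/eqP; ring.
    rewrite mulr0 addr0 -/(G x z); have := ReE z z1; have := ImE z.
    by case: (gcoef f z) (G x z) => [u v] [u' v'] /= -> ->.
  have GE z : G x z = (shift x)%:C * (z == 1%g)%:R + gcoef f z.
    by rewrite /G -fE gcoefD gcoefZ gcoef1 addrC.
  have ReN (e : bool) : complex.Re (e%:R : C) = e%:R by case: e.
  have ImN (e : bool) : complex.Im (e%:R : C) = 0 by case: e.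
  case: i => [v|[[z s]|[z s]]] /=.
  - by have := Q0 v; rewrite lecE => /andP[].
  - by rewrite GE complex_Im_scalar ImN mulr0 add0r.
  rewrite GE complex_Re_scalar ReN; case: (z == 1%g); last by rewrite mulr0 add0r.
  by case: s => //=; rewrite expr0 !mul1r mulr1 lerDr.
have feas_of l : 0 <= l -> has_psd_gram S (f + l%:C *: 1) ->
    exists2 x, (forall i, b i <= F i x) & shift x = l.
  move=> l_ge0 [P [[Ph P0] PE]]; have [X XE] := hermitian_of_real_surj Ph.
  have QE : Q (mxvec X) = P by rewrite /Q mxvecK.
  have sE : shift (mxvec X) = l.
    rewrite /shift /c /G QE -PE gcoefD gcoefZ gcoef1 eqxx mulr1.
    by rewrite raddfD /= addrC addKr.
  by exists (mxvec X) => //; apply/feasP; rewrite sE QE; split.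
have [x0 x0P sx0] := feas_of l0 l0_ge0 l0P.
have [|||x [xF xmin]] :=
    linear_program_attained (f := F) (b := b) (c := c) (B := c x0) _ _ x0P.
- move=> [v|[[z s]|[z s]]] a x y /=.
  + rewrite QL mulmxDr mulmxDl -scalemxAr -scalemxAl mxE [X in X + _]mxE.
    exact: complex_Re_scalar.
  + by rewrite GL complex_Im_scalar mulrDr mulrCA.
  + case: (_ && s); first by rewrite mulr0 addr0.
    by rewrite GL complex_Re_scalar mulrDr mulrCA.
- by move=> a x y; rewrite /c GL complex_Re_scalar.
- move=> x xF cx j; have /feasP[_ [Qpsd _]] := xF.
  case/mxvec_indexP: j => p q; rewrite -[x]vec_mxK mxvecE.
  by apply: hermitian_of_real_bounded Qpsd _ _ _; rewrite -gcoef_gram1.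
exists (shift x); have /feasP[sx [Qx fE]] := xF.
  exact: (conj sx (ex_intro _ (Q x) (conj Qx fE))).
move=> l' l'0 /(feas_of _ l'0)[y yF <-].
by rewrite /shift lerD2r; apply: xmin.
Qed.

End MinimalShift.

(** * The bound *)

Section Assembly.
Variables (R : realType) (alpha : R).
Hypotheses (halpha0 : 0 <= alpha) (halpha1 : alpha < 1).
Local Open Scope complex_scope.

Lemma delta_boundM (c w : R) d :
  delta_bound alpha c d w = delta_bound alpha c d 1 * w.
Proof. by rewrite /delta_bound; case: ifP => _; rewrite mulr1. Qed.

Lemma delta_bound2 (c : R) d : delta_bound alpha (2 * c) d 1 = 2 * delta_bound alpha c d 1.
Proof. by rewrite /delta_bound; case: ifP => _; rewrite !mulr1 ?mulrA. Qed.

Lemma best_sqrt_approx_rate : exists c : R, forall d, (0 < d)%N ->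
  sqrt_error alpha (best_sqrt_approx alpha d) <= delta_bound alpha c d 1.
Proof.
suff [c cP] : exists c : R, forall d, (0 < d)%N ->
    exists2 p : {poly R}, (size p <= d.+1)%N &
    forall t, alpha <= t <= 1 -> `|p.[t] - Num.sqrt t| <= delta_bound alpha c d 1.
  exists c => d /cP[p szp pE]; have [_ best] := best_sqrt_approxP halpha0 halpha1 d.
  exact: le_trans (best p szp) (sqrt_error_le halpha1 pE).
have [a0|a0] := ltP 0 alpha.
  have [c [c0 cP]] := sqrt_approx_geometric a0 halpha1.
  by exists c => d /cP[p szp pE]; exists p => // t /pE; rewrite /delta_bound a0 mulr1.
have aE : alpha = 0 by apply/eqP; rewrite eq_le a0.
exists 12 => d /(sqrt_approx_linear R)[p szp pE]; exists p => // t.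
by rewrite aE => /pE; rewrite /delta_bound ltxx mulr1.
Qed.

Section OneElement.
Variables (gT : finGroupType) (d : nat).
Hypothesis d0 : (0 < d)%N.
Local Notation C := (R[i] : numClosedFieldType).
Local Notation A := (group_algebra C gT).
Variable f : A.
Hypothesis fab : gbetween (alpha%:C : C) 1 f.

Lemma gevalE (p : {poly R}) : geval p f = horner_alg f (map_poly (real_complex R) p).
Proof. by []. Qed.

Lemma sqrt_supp_sub k : (k <= d)%N ->
  gsupp (geval (best_sqrt_approx alpha k) f) \subset sqrt_supp alpha f d.
Proof.
move=> kd; apply: (finset.bigcup_sup (Ordinal (kd : (k < d.+1)%N))) => //.
Qed.

(** The approximation of degree 0 is a nonzero multiple of the identity. *)
Lemma sqrt_supp1 : 1%g \in sqrt_supp alpha f d.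
Proof.
apply: (fintype.subsetP (sqrt_supp_sub (leq0n d))).
have [szb _] := best_sqrt_approxP halpha0 halpha1 0.
have := best_sqrt_approx0_neq0 halpha0 halpha1; rewrite (size1_polyC szb).
rewrite polyC_eq0 inE gevalE map_polyC horner_algC => b0.
by rewrite [gcoef _ _]gcoefZ gcoef1 eqxx mulr1 fmorph_eq0.
Qed.

(** Off the identity, the approximation of degree 1 has the support of [f],
since its slope does not vanish. *)
Lemma gsupp_sub_sqrt_supp : gsupp f \subset sqrt_supp alpha f d.
Proof.
apply/fintype.subsetP => z; rewrite inE => fz.
have [->|z1] := eqVneq z 1%g; first exact: sqrt_supp1.
apply: (fintype.subsetP (sqrt_supp_sub d0)).
have [szb _] := best_sqrt_approxP halpha0 halpha1 1.
have b1 := best_sqrt_approx1_slope halpha0 halpha1.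
set b := best_sqrt_approx alpha 1 in szb b1 *.
have -> : b = (b`_1)%:P * 'X + (b`_0)%:P.
  apply/polyP => -[|[|i]]; rewrite coefD coefMX coefC /= ?add0r // coefC ?addr0 //=.
  by rewrite nth_default // (leq_trans szb).
rewrite inE gevalE rmorphD rmorphM /= map_polyX !map_polyC rmorphD rmorphM /=.
rewrite horner_algX !horner_algC [gcoef _ _]gcoefD [X in _ + X]gcoefZ gcoef1 (negbTE z1).
rewrite mulr0 addr0 -scalerAl mul1r [gcoef _ _]gcoefZ mulf_neq0 // fmorph_eq0 //.
Qed.

Lemma min_shift_le (B : nat -> {set gT}) k (m : nat) :
    (forall i, 1%g \in B i) ->
    (forall i j x y, x \in B i -> y \in B j -> (x * y)%g \in B (i + j)%N) ->
    gsupp f \subset B k -> (#|B (2 * d * k)%N| <= m)%N ->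
  exists2 delta : R, is_min (gram_shifts alpha f d) delta &
    delta <= sqrt_error alpha (best_sqrt_approx alpha d) * (3 * Num.sqrt m%:R).
Proof.
move=> B1 BM fB cardB.
set p := best_sqrt_approx alpha d; set e := sqrt_error alpha p.
have [szp best] : is_best_sqrt_approx alpha d p := best_sqrt_approxP halpha0 halpha1 d.
have e0 : 0 <= e.
  by apply: le_trans (sqrt_error_ub halpha0 p (_ : alpha <= (1 : R) <= 1)); rewrite // ltW /=.
have e1 : e <= 1.
  have /best/le_trans : (size (0%R : {poly R}) <= d.+1)%N by rewrite size_poly0.
  apply; apply: (sqrt_error_le halpha1) => t /sqrt_le1/andP[s0 s1].
  by rewrite horner0 sub0r normrN ger0_norm.
pose q : {poly C} := map_poly (real_complex R) p.
have qR : q \is a polyOver Num.real.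
  by apply/polyOverP => i; rewrite coef_map; apply/complex_realP; eexists.
have szq : (size ('X - q ^+ 2)%R <= (2 * d).+1)%N.
  rewrite (leq_trans (size_polyD _ _)) // geq_max size_polyX size_polyN; apply/andP; split.
    by rewrite ltnS muln_gt0.
  rewrite (leq_trans (size_poly_exp_leq _ _)) // ltnS mulnC leq_mul // size_map_poly.
  by case: (size p) szp.
have le_norm_real (x y : R) : (`|x%:C : C| <= (y%:C : C)) = (`|x| <= y).
  by rewrite [`|_|]normc_def /= expr0n addr0 sqrtr_sqr [LHS]lecR.
have qE (t : C) : alpha%:C <= t <= 1 -> `|t - q.[t] ^+ 2| <= (3 * e)%:C.
  case: t => u v /andP[ut t1].
  have /andP[/eqP v0 au] : (v == 0) && (alpha <= u) by move: ut; rewrite lecE.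
  have u1 : u <= 1 by move: t1; rewrite lecE => /andP[].
  rewrite v0; have tP : alpha <= u <= 1 by rewrite au u1.
  have := sqrt_error_ub halpha0 p tP; have /andP[s0 s1] := sqrt_le1 tP.
  rewrite -/e; have -> : (u +i* 0) - q.[u +i* 0] ^+ 2 = (u - p.[u] ^+ 2)%:C :> C.
    by rewrite [u +i* 0]complexr0 horner_map rmorphB rmorphXn.
  rewrite le_norm_real.
  have -> : u - p.[u] ^+ 2 = (Num.sqrt u - p.[u]) * (Num.sqrt u + p.[u]).
    by rewrite -subr_sqr sqr_sqrtr // (le_trans halpha0 au).
  rewrite normrM distrC => pe.
  have : `|Num.sqrt u + p.[u]| <= 3.
    move: pe; rewrite !ler_norml => /andP[? ?]; apply/andP; split; lra.
  move=> pe3; rewrite mulrC ler_pM //.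
have gB : gsupp (horner_alg f ('X - q ^+ 2)) \subset B (2 * d * k)%N.
  exact: gsupp_horner_alg.
have [l [l0 l2 lP]] := gram_certificate fab qR (sqrt_supp_sub (leqnn d))
  gsupp_sub_sqrt_supp sqrt_supp1 qE (leq_trans (subset_leq_card gB) cardB).
have lE : l = (complex.Re l)%:C by rewrite RRe_real // ger0_real.
set r := complex.Re l in lE.
have r0 : 0 <= r by move: l0; rewrite lE lecR.
have rle : r <= e * (3 * Num.sqrt m%:R).
  have : r ^+ 2 <= m%:R * (3 * e) ^+ 2.
    by move: l2; rewrite lE -rmorphXn -(rmorph_nat (real_complex R)) -rmorphXn -rmorphM lecR.
  move=> r2; rewrite -[r]ger0_norm // -sqrtr_sqr.
  have -> : e * (3 * Num.sqrt m%:R) = Num.sqrt (m%:R * (3 * e) ^+ 2).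
    rewrite sqrtrM ?ler0n // sqrtr_sqr ger0_norm ?mulr_ge0 //; ring.
  by rewrite ler_wsqrtr.
have rP : has_psd_gram (sqrt_supp alpha f d) (f + r%:C *: 1) by rewrite -lE.
have [delta [del0 delP] delmin] := gram_shift_min (ex_intro _ r (conj r0 rP)).
exists delta; last exact: le_trans (delmin r r0 rP) rle.
split; first exact: (conj del0 delP).
move=> l' [l'0 l'P]; exact: (delmin l' l'0 l'P).
Qed.

End OneElement.

End Assembly.

Local Open Scope complex_scope.

Theorem corollary5p15 (R : realType) (alpha : R)
    (halpha0 : 0 <= alpha) (halpha1 : alpha < 1) :
  exists c : R, forall N : nat, (0 < N)%N ->
    (forall (gT : finGroupType) (y : gT),
       <[y]>%g = [set: gT] -> #[y]%g = N ->
       forall f : group_algebra R[i] gT, gbetween alpha%:C 1 f ->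
       forall d : nat, (0 < d)%N ->
       forall k : nat, is_bandwidth (cyclic_band N y) (gsupp f) k ->
       exists2 delta : R, is_min (gram_shifts alpha f d) delta &
         delta <= delta_bound alpha c d
                    (3 * Num.sqrt (4 * d%:R * k%:R + 1))) /\
    (forall (gT : finGroupType) (s t : gT),
       <<[set s; t]>>%g = [set: gT] -> #|gT| = (2 * N)%N ->
       (s ^+ N = 1)%g -> (t ^+ 2 = 1)%g -> ((s * t) ^+ 2 = 1)%g ->
       forall f : group_algebra R[i] gT, gbetween alpha%:C 1 f ->
       forall d : nat, (0 < d)%N ->
       forall k : nat, is_bandwidth (dihedral_band N s t) (gsupp f) k ->
       exists2 delta : R, is_min (gram_shifts alpha f d) delta &
         delta <= delta_bound alpha c d
                    (3 * Num.sqrt (8 * d%:R * k%:R + 1))).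
Proof.
have [c cP] := best_sqrt_approx_rate halpha0 halpha1.
have b0 d : (0 < d)%N -> 0 <= delta_bound alpha c d 1.
  move=> /cP; apply: le_trans.
  by apply: le_trans (sqrt_error_ub halpha0 _ (_ : alpha <= (1 : R) <= 1)); rewrite // ltW /=.
exists (2 * c) => N N0; split.
  move=> gT y _ yN f fab d d0 k [_ fB _].
  have {}yN : (y ^+ N = 1)%g by rewrite -yN expg_order.
  have [delta dmin dle] := min_shift_le halpha0 halpha1 d0 fab
    (fun i => cyclic_band1 i N0 yN) (fun i j u v => @cyclic_bandM _ N y i j u v N0 yN)
    fB (card_cyclic_band _ N0 yN).
  exists delta => //; apply: le_trans dle _; rewrite delta_boundM delta_bound2.
  have -> : (2 * (2 * d * k) + 1)%:R = 4 * d%:R * k%:R + 1 :> R.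
    by rewrite natrD !natrM; ring.
  rewrite ler_wpM2r ?mulr_ge0 ?sqrtr_ge0 //.
  by apply: le_trans (cP d d0) _; have := b0 d d0; lra.
move=> gT s t _ _ sN t2 st2 f fab d d0 k [_ fB _].
have B1 i : 1%g \in dihedral_band N s t i.
  by rewrite finset.in_setU cyclic_band1.
have [delta dmin dle] := min_shift_le halpha0 halpha1 d0 fab
  B1 (fun i j u v => @dihedral_bandM _ N s t i j u v N0 sN t2 st2)
  fB (card_dihedral_band _ _ N0 sN).
exists delta => //; apply: le_trans dle _; rewrite delta_boundM delta_bound2.
have -> : (4 * (2 * d * k) + 2)%:R = 8 * d%:R * k%:R + 2 :> R.
  by rewrite natrD !natrM; ring.
set x := 8 * d%:R * k%:R; have x0 : 0 <= x by rewrite !mulr_ge0.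
(* 8 d k + 2 bounds the band, where 8 d k + 1 is wanted *)
have sx : Num.sqrt (x + 2) <= 2 * Num.sqrt (x + 1).
  rewrite -[2 * _]ger0_norm ?mulr_ge0 ?sqrtr_ge0 // -sqrtr_sqr ler_wsqrtr //.
  rewrite exprMn sqr_sqrtr; lra.
have := cP d d0; have := b0 d d0; set D := delta_bound _ _ _ _ => D0 eD.
apply: le_trans (_ : D * (3 * Num.sqrt (x + 2)) <= _).
  by rewrite ler_wpM2r ?mulr_ge0 ?sqrtr_ge0.
have -> : 2 * D * (3 * Num.sqrt (x + 1)) = D * (3 * (2 * Num.sqrt (x + 1))) by ring.
by rewrite !ler_wpM2l.
Qed.
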